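(* Let $Q=\left(\begin{array}{cc} q_1 & q\\ q^* & q_2\end{array}\right)=Q_1+Q_2$ be a complex valued $2\times 2$ matrix function, with $q_1,q_2$ real valued, $q$ complex valued and $q^*$ the complex conjugate of $q$, which is $\pi$-periodic and integrable on $[0,\pi)$, where $$Q_1=\mathrm{Re}(q)\,\sigma_1+\tfrac12(q_1-q_2)\,\sigma_3,\qquad Q_2=\tfrac12(q_1+q_2)\,\sigma_0+\mathrm{Im}(q)\,\sigma_2 .$$ The $2\times 2$ matrix solutions $\mathbb{Y}$ and $\mathbb{U}$ of $JY'+QY=\lambda Y$ satisfying the conditions $\mathbb{Y}(0)=\mathbb{I}=\mathbb{U}(\pi)$ are of order $1$. For $z\in\mathbb{R}$ and $\lambda=re^{i\theta}$ with $r\to\infty$, we have, uniformly in $\theta$ and $z$, that $$\mathbb{Y}(z)=e^{-J\lambda z}\,e^{J\int_0^z Q_2\,dt}+o\big(e^{|\mathrm{Im}\,\lambda z|}\big),$$ $$\mathbb{U}(z)=e^{-J\lambda(\pi-z)}\,e^{J\int_0^{(\pi-z)} Q_2\,dt}+o\big(e^{|\mathrm{Im}\,\lambda(\pi-z)|}\big).$$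
   Context: Here $J=\left(\begin{array}{cc}0&1\\-1&0\end{array}\right)$, $\mathbb{I}=\sigma_0$ is the $2\times2$ identity matrix, $\sigma_1=\left(\begin{array}{cc}0&1\\1&0\end{array}\right)$, $\sigma_2=\left(\begin{array}{cc}0&i\\-i&0\end{array}\right)=iJ$ and $\sigma_3=\left(\begin{array}{cc}1&0\\0&-1\end{array}\right)$. $\lambda\in\mathbb{C}$ is the eigenparameter, and $\mathbb{Y}(z)=\mathbb{Y}(z,\lambda)$, $\mathbb{U}(z)=\mathbb{U}(z,\lambda)$; ''of order $1$'' refers to their order as entire functions of $\lambda$. Matrices are measured in the operator norm $|[c_{ij}]|=\max_j\sum_i|c_{ij}|$, and $o(g)$ denotes a matrix whose norm divided by $g$ tends to $0$ as $r\to\infty$. $\mathrm{Im}\,\lambda z$ means $\mathrm{Im}(\lambda z)$, and likewise $\mathrm{Im}\,\lambda(\pi-z)$ means $\mathrm{Im}(\lambda(\pi-z))$.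
   Formalization: In the exponents and integral limit of the leading term for U, π−z is corrected to z−π; uniformity in z is on compact subsets of ℝ, as it fails on all of ℝ; order 1 is claimed for z≠0 (Y) and z≠π (U), where the solution is not the constant identity. *)

(* Defs.v *)
From HB Require Import structures.
From mathcomp Require Export all_boot all_order all_algebra.
From mathcomp Require Export complex.
From mathcomp Require Import lra.
From mathcomp Require Export all_classical all_reals all_analysis.
Export Order.TTheory GRing.Theory Num.Theory.
Export numFieldNormedType.Exports.
Set Implicit Arguments.
Unset Strict Implicit.
Unset Printing Implicit Defensive.
Local Open Scope classical_set_scope.
Local Open Scope ring_scope.

(* [real_closed] gives [R[i]] no topology; transport the one the library puts
   on [K^o] for every numFieldType [K], i.e. that of the complex modulus. *)
HB.instance Definition _ (R : rcfType) := PseudoPointedMetric.copy R[i] R[i]^o.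
HB.instance Definition _ (R : rcfType) := GRing.ComAlgebra.copy R[i] R[i]^o.
HB.instance Definition _ (R : rcfType) := Vector.copy R[i] R[i]^o.
HB.instance Definition _ (R : rcfType) := NormedModule.copy R[i] R[i]^o.

Section matrices.
Context {R : realType}.
Local Notation C := R[i].
Local Notation M2 := 'M[C]_2.

Definition mx2 (a b c d : C) : M2 :=
  \matrix_(i, j) if i == 0 then (if j == 0 then a else b)
                 else (if j == 0 then c else d).

Definition Jmx : M2 := mx2 0 1 (-1) 0.
Definition sigma0 : M2 := 1%:M.
Definition sigma1 : M2 := mx2 0 1 1 0.
Definition sigma2 : M2 := mx2 0 (Complex 0 1) (- Complex 0 1) 0.
Definition sigma3 : M2 := mx2 1 0 0 (-1).

Definition opnorm (A : M2) : R :=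
  \big[Num.max/0]_(j < 2) \sum_(i < 2) Normc.normc (A i j).

Definition expmx (A : M2) : M2 :=
  limn (series (fun k : nat => k`!%:R^-1 *: A ^+ k)).

Definition polar (r theta : R) : C := Complex (r * cos theta) (r * sin theta).

End matrices.

Section potential.
Context {R : realType}.
Local Notation C := R[i].
Variables (q1 q2 : R -> R) (q : R -> C).

Definition Qmx (t : R) : 'M[C]_2 :=
  mx2 (q1 t)%:C%C (q t) (conjc (q t)) (q2 t)%:C%C.

Definition Q1mx (t : R) : 'M[C]_2 :=
  (complex.Re (q t))%:C%C *: sigma1 + (2^-1 * (q1 t - q2 t))%:C%C *: sigma3.

Definition Q2mx (t : R) : 'M[C]_2 :=
  (2^-1 * (q1 t + q2 t))%:C%C *: sigma0 + (complex.Im (q t))%:C%C *: sigma2.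

Lemma QmxE t : Qmx t = Q1mx t + Q2mx t.
Proof.
have half (x y : R) : 2^-1 * (x - y) + 2^-1 * (x + y) = x by lra.
have half' (x y : R) : - (2^-1 * (x - y)) + 2^-1 * (x + y) = y by lra.
have scaleE (x : C) (A : 'M[C]_2) i j : (x *: A) i j = x * A i j by rewrite mxE.
have mx2E (a b c d : C) i j : mx2 a b c d i j =
  if i == 0 then (if j == 0 then a else b) else (if j == 0 then c else d).
  by rewrite mxE.
have idE i j : (1%:M : 'M[C]_2) i j = (i == j)%:R by rewrite mxE.
have ord2 (k : 'I_2) : (k == 0) || (k == 1) by case: k => [[|[|]]].
rewrite /Qmx /Q1mx /Q2mx; case: (q t) => a b /=.
apply/matrixP => i j; rewrite [LHS]mxE [RHS]mxE.
rewrite ![X in _ = X + _]mxE ![X in _ = _ + X]mxE.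
rewrite 4!scaleE /sigma0 /sigma1 /sigma2 /sigma3 idE 3!mx2E.
case/orP: (ord2 i) => /eqP ->; case/orP: (ord2 j) => /eqP -> /=;
  apply/eqP; rewrite eq_complex /= !(mulr0, mulr1, mul0r, mulrN, oppr0,
    subr0, addr0, add0r) ?half ?half' ?eqxx //.
Qed.

End potential.

Section integration.
Context {R : realType}.
Local Notation C := R[i].
Local Notation mu := (@lebesgue_measure R).

Definition mx_integrable (D : set R) (A : R -> 'M[C]_2) : Prop :=
  forall i j, mu.-integrable D (fun t => (complex.Re (A t i j))%:E) /\
              mu.-integrable D (fun t => (complex.Im (A t i j))%:E).

(* Oriented Lebesgue integral: [oint f a b = - oint f b a]. *)
Definition oint (f : R -> R) (a b : R) : R :=
  if a <= b then \int[mu]_(t in `[a, b]) f t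
  else - \int[mu]_(t in `[b, a]) f t.

Definition mx_oint (A : R -> 'M[C]_2) (a b : R) : 'M[C]_2 :=
  \matrix_(i, j) Complex (oint (fun t => complex.Re (A t i j)) a b)
                         (oint (fun t => complex.Im (A t i j)) a b).

End integration.

Section solutions.
Context {R : realType}.
Local Notation C := R[i].
Local Notation mu := (@lebesgue_measure R).

(* [s] lists the end points of finitely many nonoverlapping subintervals. *)
Definition abs_cont (a b : R) (f : R -> R) : Prop :=
  forall eps : R, 0 < eps -> exists2 delta : R, 0 < delta &
  forall s : seq (R * R),
    all (fun p => [&& a <= p.1, p.1 <= p.2 & p.2 <= b]) s ->
    pairwise (fun p p' => (p.2 <= p'.1) || (p'.2 <= p.1)) s ->
    \sum_(p <- s) (p.2 - p.1) < delta ->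
    \sum_(p <- s) `|f p.2 - f p.1| < eps.

Definition mx_abs_cont (a b : R) (Y : R -> 'M[C]_2) : Prop :=
  forall i j, abs_cont a b (fun t => complex.Re (Y t i j)) /\
              abs_cont a b (fun t => complex.Im (Y t i j)).

Definition mx_derivable (Y : R -> 'M[C]_2) (z : R) : Prop :=
  forall i j, derivable (fun t => complex.Re (Y t i j)) z 1 /\
              derivable (fun t => complex.Im (Y t i j)) z 1.

Definition mx_derive (Y : R -> 'M[C]_2) (z : R) : 'M[C]_2 :=
  \matrix_(i, j) Complex (derive1 (fun t => complex.Re (Y t i j)) z)
                         (derive1 (fun t => complex.Im (Y t i j)) z).

(* As [Q] is only locally integrable, solutions are taken in the sense of
   Caratheodory. *)
Definition is_solution (Q : R -> 'M[C]_2) (lam : C) (Y : R -> 'M[C]_2) : Prop :=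
  (forall a b, a <= b -> mx_abs_cont a b Y) /\
  {ae mu, forall z, mx_derivable Y z /\
     Jmx *m mx_derive Y z + Q z *m Y z = lam *: Y z}.

End solutions.

Section growth.
Context {R : realType}.
Local Notation C := R[i].

Definition entire (F : C -> 'M[C]_2) : Prop := forall lam, derivable F lam 1.

Definition max_modulus (F : C -> 'M[C]_2) (r : R) : R :=
  sup [set opnorm (F lam) | lam in [set lam | Normc.normc lam = r]].

(* limsup of log log M(r) / log r; [ln] is 0 on nonpositive reals, so that
   constants have order 0. *)
Definition growth_order (F : C -> 'M[C]_2) : \bar R :=
  limf_esup (fun r : R => (ln (ln (max_modulus F r)) / ln r)%:E) +oo.

(* E(z, lam) = o(g(z, lam)) as lam = r e^{i theta}, r --> +oo, uniformly in
   theta and in z \in K. *)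
Definition unif_littleo (K : set R) (E : R -> C -> 'M[C]_2) (g : R -> C -> R)
    : Prop :=
  forall eps : R, 0 < eps -> \forall r \near +oo, forall theta z, K z ->
    opnorm (E z (polar r theta)) <= eps * g z (polar r theta).

End growth.

(* Main.v *)
(* In the eigenbasis of J the system JY' + QY = lam Y becomes, with om = -i lam,
     y1' = (om + i al1) y1 + k1 y2,   y2' = (-om + i al2) y2 + k2 y1,
   where the real al1, al2 come from Q2, which commutes with J, and k1, k2 from
   Q1, which anticommutes with J.  A Gronwall estimate for |y1|^2 + |y2|^2 gives
   |y1(t)|, |y2(t)| <= c e^{|Re om| |t|} with c independent of om.  Stripping the
   diagonal part off y1 and y2 leaves u and v with u' = K e^{-2 om t} v; if P is
   the primitive of K e^{-2 om t} vanishing at z, then (u - P v)' = - P v', and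
   the Riemann-Lebesgue lemma makes P small, uniformly in the direction of om.
   The difference quotients in lam solve the same system with a forcing term, so
   the Gronwall estimate also shows that they are Cauchy.
   Every estimate is an inequality between derivatives holding almost everywhere
   that is integrated between absolutely continuous functions. *)
Require Import Defs.
From mathcomp Require Import lra ring measurable_realfun.
Set Implicit Arguments.
Unset Strict Implicit.
Unset Printing Implicit Defensive.
Local Open Scope classical_set_scope.
Local Open Scope ring_scope.

(** * Absolutely continuous functions and their derivatives *)

(** Riemann-Lebesgue cannot be applied to [K e^{-2 om t} v] directly: it makes the integral small
    for a fixed [K] only, while [v] varies with [om] and may be exponentially large. Passing to
    [u - P v] moves the derivative onto [v]. Since [v] has lost its diagonal part, [v'] is an
    exponential times [k2 y1], with no factor [om], so the small [P] is integrated against an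
    integrable kernel. Normalizing [P] at [z] instead of [0] matters for the weights: the
    exponential bounds of [P(t)], of the factor [e^{om t}] and of [y1(t)] then multiply to a
    quantity free of [t], whatever the sign of [Re om], and the only boundary term is [P(0) y2(0)].
    The rate is exactly [|Im lam|] because the energy does not see the imaginary parts of the
    diagonal coefficients. The main term is a product of two matrix exponentials of matrices
    [a I + b J]; these share their eigenvectors, so everything reduces to scalar exponentials. That
    the order is not below 1 follows from the asymptotics themselves, on the half of the imaginary
    axis where [Im (lam z) = |lam z|]. *)

Section absolute_continuity.
Context {R : realType}.
Local Notation mu := (@lebesgue_measure R).
Implicit Types (f g h : R -> R) (a b : R).

(** Absolute continuity of sums, products and compositions all reduces to this one domination of
    increments. *)
Lemma abs_cont_dom (K : R) f g h a b : abs_cont a b f -> abs_cont a b g ->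
  (forall x y, a <= x -> x <= y -> y <= b ->
    `|h y - h x| <= K * (`|f y - f x| + `|g y - g x|)) ->
  abs_cont a b h.
Proof.
move=> cf cg dom e e0.
pose K' : R := `|K| + 1; have K'0 : 0 < K' by rewrite ltr_wpDl.
have e'0 : 0 < e / (2 * K') by rewrite divr_gt0// mulr_gt0.
have [d1 d10 H1] := cf _ e'0; have [d2 d20 H2] := cg _ e'0.
exists (Num.min d1 d2) => [|s sab sd]; first by rewrite lt_min d10.
rewrite lt_min => /andP[/(H1 s sab sd) s1 /(H2 s sab sd) s2].
have -> : e = K' * (e / (2 * K') + e / (2 * K')).
  by field; rewrite gt_eqF.
apply: (@le_lt_trans _ _ (K' * (\sum_(p <- s) `|f p.2 - f p.1| +
                               \sum_(p <- s) `|g p.2 - g p.1|))); last first.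
  by rewrite ltr_pM2l// ltrD.
rewrite -big_split/= mulr_sumr big_seq [leRHS]big_seq ler_sum// => p ps.
have /and3P[ap1 p12 p2b] := allP sab p ps.
apply: le_trans (dom _ _ ap1 p12 p2b) _.
by rewrite ler_wpM2r ?addr_ge0// (le_trans (ler_norm _))// lerDl.
Qed.

Lemma abs_cont_id a b : abs_cont a b id.
Proof.
move=> e e0; exists e => // s sab _; apply: le_lt_trans.
rewrite big_seq [leRHS]big_seq ler_sum// => p ps.
by have /and3P[_ p12 _] := allP sab p ps; rewrite ger0_norm ?subr_ge0.
Qed.

Lemma abs_cont_lipschitz (K : R) f a b :
  (forall x y, a <= x -> x <= y -> y <= b -> `|f y - f x| <= K * (y - x)) ->
  abs_cont a b f.
Proof.
move=> fK; apply: (@abs_cont_dom `|K| id id); [exact: abs_cont_id..|].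
move=> x y ax xy yb; apply: le_trans (fK x y ax xy yb) _ => /=.
have xy0 : 0 <= y - x by rewrite subr_ge0.
rewrite (ger0_norm xy0); have := ler_norm K; have := normr_ge0 K; nra.
Qed.

Lemma abs_cont_itvP a b f : abs_cont a b f -> forall e, 0 < e ->
  exists2 d : R, 0 < d & forall x y, a <= x -> x <= y -> y <= b -> y - x < d ->
    `|f y - f x| < e.
Proof.
move=> cf e e0; have [d d0 H] := cf e e0; exists d => // x y ax xy yb xyd.
have := H [:: (x, y)]; rewrite /= !big_cons !big_nil !addr0/= ax xy yb.
exact.
Qed.

(** A relation, so that a local absolute continuity claim always travels with a formula for the
    derivative; [g] matters only up to a null set. *)
Definition acd f g := (forall a b, a <= b -> abs_cont a b f) /\
  {ae mu, forall x : R, is_derive x 1 f (g x)}.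

Lemma acd_continuous f g : acd f g -> continuous f.
Proof.
move=> [cf _] x; apply/cvgrPdist_lt => e e0.
have xx : x - 1 <= x + 1 by lra.
have [d d0 H] := abs_cont_itvP (cf _ _ xx) e0.
have m0 : 0 < Num.min d 1 by rewrite lt_min d0 ltr01.
near=> y.
have : `|x - y| < Num.min d 1 by near: y; exact: cvgr_dist_lt.
rewrite lt_min ltr_norml => /andP[/andP[yd1 yd2] /ltr_normlP[y1 y2]].
case: (leP x y) => xy; last first.
  by apply: H => //; [lra|exact: ltW|lra].
by rewrite distrC; apply: H => //; lra.
Unshelve. all: by end_near. Qed.

Lemma is_derive_near f (c l e : R) : is_derive c 1 f l -> 0 < e ->
  exists2 eta : R, 0 < eta & forall y, `|y - c| < eta ->
    `|f y - f c - l * (y - c)| <= e * `|y - c|.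
Proof.
move=> [/cvg_ex[l' fl'] <-] e0.
have -> : 'D_1 f c = l' by apply: cvg_lim.
move/cvgrPdist_le : fl' => /(_ e e0)[eta/= eta0 H]; exists eta => // y yc.
have [->|yc0] := eqVneq y c; first by rewrite !subrr mulr0 subr0 normr0 mulr0.
have yc1 : y - c != 0 by rewrite subr_eq0.
have := H (y - c); rewrite /= sub0r normrN => /(_ yc yc1).
have -> : (y - c) *: 1 + c = y :> R by rewrite /GRing.scale/= mulr1 subrK.
rewrite /GRing.scale/= => le.
rewrite (_ : f y - f c - l' * (y - c) =
  - (l' - (y - c)^-1 * (f y - f c)) * (y - c)); last by field.
by rewrite normrM normrN ler_pM2r// normr_gt0.
Qed.

(* Real induction: a point where the derivative is nonpositive lets the endpoint
   move at the cost of slope [e]; the remaining null set lies in an open set of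
   small measure, where the increments are controlled by absolute continuity. *)
Lemma acd_le0 f g a b : a <= b -> acd f g ->
  {ae mu, forall x, a <= x <= b -> g x <= 0} -> f b <= f a.
Proof.
move=> ab [cf df] g0.
(* One [e] pays for the slope away from the exceptional set, the other for the total increment
   across it. *)
suff main (e : R) : 0 < e -> f b - f a <= e * (b - a) + e.
  rewrite -subr_le0; apply/ler_addgt0Pr => e e0; rewrite add0r.
  have ba1 : 0 < b - a + 1 by rewrite ltr_wpDl// subr_ge0.
  have := main (e / (b - a + 1)) (divr_gt0 e0 ba1).
  by congr (_ <= _); field; rewrite gt_eqF.
move=> e0; have [d d0 fd] := cf _ _ ab _ e0.
have [A [mA A0 NA]] : mu.-negligible (~` [set x : R | is_derive x 1 f (g x) /\
    (a <= x <= b -> g x <= 0)]).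
  exact: (@filterI _ _ (ae_filter_ringOfSetsType mu) _ _ df g0).
have Aoo : (mu A < +oo)%E by rewrite A0 ltry.
have [|U [oU AU Ud]] := @lebesgue_regularity_outer R A d mA _ d0.
  exact: Aoo.
have mU : measurable U by exact: open_measurable.
have {}Ud : (mu U < d%:E)%E.
  rewrite -(setDUK AU); apply: le_lt_trans Ud.
  apply: le_trans (measureU2 _ _ _) _ => //; first exact: measurableD.
  by rewrite -[leRHS]add0e -A0.
(* The points reached so far. The list [s] collects the steps made inside the open set [U]; its
   total length is charged to the part of [U] left of [x], half-open so that a later step from [x]
   is charged to a disjoint part. *)
pose S := [set x | a <= x <= b /\ exists s : seq (R * R),
  [/\ all (fun p => [&& a <= p.1, p.1 <= p.2 & p.2 <= x]) s,
      pairwise (fun p p' => (p.2 <= p'.1) || (p'.2 <= p.1)) s,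
      ((\sum_(p <- s) (p.2 - p.1))%:E <= mu (U `&` `[a, x[))%E &
      f x - f a <= e * (x - a) + \sum_(p <- s) `|f p.2 - f p.1|]].
have Sa : S a.
  split; first by rewrite lexx.
  by exists [::]; split => //; rewrite ?big_nil ?subrr ?mulr0 ?addr0.
have Sstep x v : S x -> x <= v -> v <= b ->
    f v - f x <= e * (v - x) \/ `[x, v[ `<=` U -> S v.
  move=> [/andP[ax xb] [s [s1 s2 s3 s4]]] xv vb H.
  have av := le_trans ax xv.
  split; first by rewrite av.
  have s1v : all (fun p => [&& a <= p.1, p.1 <= p.2 & p.2 <= v]) s.
    apply/allP => p /(allP s1)/and3P[-> -> /=] px; exact: le_trans xv.
  have m1 : measurable (U `&` `[a, x[) by exact: measurableI.
  have m2 : measurable (U `&` `[a, v[) by exact: measurableI.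
  have muxv : ((v - x)%:E <= mu `[x, v[)%E.
    rewrite /= lebesgue_measure_itv/= lte_fin.
    by case: ltP => // vx; rewrite lee_fin subr_le0.
  case: H => [fvx|xvU].
    exists s; split => //.
      apply: le_trans s3 _; apply: le_measure; rewrite ?inE//.
      apply: setIS => y /=; rewrite !in_itv/= => /andP[-> yx]/=.
      exact: lt_le_trans xv.
    by move: s4 fvx; lra.
  exists ((x, v) :: s); split => /=.
  - by rewrite ax xv lexx.
  - rewrite s2 andbT; apply/allP => p /(allP s1)/and3P[_ _ px].
    by rewrite px orbT.
  - rewrite big_cons/=.
    apply: (@le_trans _ _ (mu (`[x, v[ `|` (U `&` `[a, x[)))).
      rewrite measureU//; last first.
        rewrite -subset0 => y /= []; rewrite in_itv/= => /andP[xy _] [_].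
        by rewrite in_itv/= => /andP[_]; rewrite ltNge xy.
      by rewrite EFinD; exact: leeD muxv s3.
    apply: le_measure; rewrite ?inE//; first exact: measurableU.
    move=> y [yxv|[yU]]; first split; first exact: xvU.
      by move: yxv; rewrite /= !in_itv/= => /andP[/(le_trans ax)->].
    rewrite /= !in_itv/= => /andP[-> yx]; split => //=.
    exact: lt_le_trans xv.
  - rewrite big_cons/=; move: s4 (ler_norm (f v - f x)).
    have : 0 <= e * (v - x) by rewrite mulr_ge0 ?subr_ge0// ltW.
    by lra.
have Sb x : S x -> x <= b by case=> /andP[].
have hS : has_sup S by split; [exists a|exists b => x /Sb].
pose c := sup S.
have ac : a <= c by exact: ub_le_sup (proj2 hS) _ Sa.
have cb : c <= b by apply: ge_sup => //; exists a.
(* At the supremum [c] either [U] contains a neighbourhood, and any step across [c] can be charged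
   to it, or [c] avoids the null set and the derivative bound at [c] controls every interval that
   straddles [c]. *)
have [eta eta0 Heta] : exists2 eta : R, 0 < eta & forall u v, c - eta < u -> u <= c ->
    c <= v -> v < c + eta -> f v - f u <= e * (v - u) \/ `[u, v[ `<=` U.
  have [cU|cU] := pselect (U c).
    have [eta/= eta0 H] := (nbhs_ballP c U).1 (open_nbhs_nbhs (conj oU cU)).
    exists eta => // u v uc1 uc2 cv1 cv2; right => y /=; rewrite in_itv/= => /andP[uy yv].
    by apply: H; rewrite /ball/= ltr_norml; apply/andP; split; lra.
  have [dc gc] : is_derive c 1 f (g c) /\ (a <= c <= b -> g c <= 0).
    by apply: contrapT => /NA /AU.
  have [eta eta0 H] := is_derive_near dc e0.
  exists eta => // u v uc1 uc2 cv1 cv2; left.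
  have := H v; rewrite ger0_norm ?subr_ge0// => /(_ _)/ler_normlP[|_ Hv]; first by lra.
  have := H u; rewrite ler0_norm ?subr_le0// => /(_ _)/ler_normlP[|Hu _]; first by lra.
  have := gc; rewrite ac cb => /(_ isT) gc0.
  have : g c * (v - c) <= 0 by nra.
  have : g c * (u - c) >= 0 by nra.
  by lra.
have [x Sx cx] := sup_adherent eta0 hS.
have xc : x <= c by exact: ub_le_sup (proj2 hS) _ Sx.
(* Overshooting [c] by [eta / 2] contradicts the supremum unless [b] has been reached. *)
pose v := Num.min b (c + eta / 2).
have vb : v <= b by rewrite ge_min lexx.
have cv : c <= v by rewrite le_min cb lerDl divr_ge0// ltW.
have Sv : S v.
  apply: (Sstep x) => //; first exact: le_trans cv.
  apply: Heta => //; rewrite gt_min; apply/orP; right; lra.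
have vc : v <= c by exact: ub_le_sup (proj2 hS) _ Sv.
have bc : b <= c.
  move: vc; rewrite /v ge_min => /orP[//|]; lra.
have {Sv} : S b by rewrite (_ : b = v)//; apply/eqP; rewrite eq_le vb (le_trans bc).
move=> [_ [s [s1 s2 s3 s4]]].
apply: le_trans s4 _; rewrite lerD2l ltW// fd//.
rewrite -lte_fin; apply: le_lt_trans s3 _; apply: le_lt_trans Ud.
by apply: le_measure; rewrite ?inE//; exact: measurableI.
Qed.


Lemma continuous_bounded f a b : continuous f ->
  exists2 M : R, 0 <= M & forall x, a <= x -> x <= b -> `|f x| <= M.
Proof.
move=> cf; case: (leP a b) => ab; last first.
  by exists 0 => // x ax xb; move: (le_trans ax xb); rewrite leNgt ab.
have cn : {within `[a, b], continuous (fun x => `|f x|)}.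
  apply: continuous_subspaceT => x.
  by apply: continuous_comp; [exact: cf|exact: norm_continuous].
have [c _ H] := EVT_max ab cn.
by exists `|f c| => // x ax xb; apply: H; rewrite in_itv/= ax.
Qed.

Lemma acd_bounded f g a b : acd f g ->
  exists2 M : R, 0 <= M & forall x, a <= x -> x <= b -> `|f x| <= M.
Proof. by move=> /acd_continuous; exact: continuous_bounded. Qed.

Lemma acd_cst (c : R) : acd (fun=> c) (fun=> 0).
Proof.
split=> [a b _|].
  by apply: (@abs_cont_lipschitz 0) => x y _ _ _; rewrite subrr normr0 mul0r.
by apply: aeW => x; exact: is_derive_cst.
Qed.

Lemma acd_id : acd id (fun=> 1).
Proof.
split=> [a b _|]; first exact: abs_cont_id.
by apply: aeW => x; exact: is_derive_id.
Qed.

Lemma acdD f f' g g' : acd f f' -> acd g g' ->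
  acd (fun x => f x + g x) (fun x => f' x + g' x).
Proof.
move=> [cf df] [cg dg]; split=> [a b ab|].
  apply: (abs_cont_dom (cf _ _ ab) (cg _ _ ab) (K := 1)) => x y _ _ _.
  by rewrite mul1r opprD addrACA ler_normD.
apply: (@filterS2 _ _ (ae_filter_ringOfSetsType mu) _ _ _ _ df dg).
by move=> x fx gx; exact: is_deriveD.
Qed.

Lemma acdM f f' g g' : acd f f' -> acd g g' ->
  acd (fun x => f x * g x) (fun x => f' x * g x + f x * g' x).
Proof.
move=> af ag; have [cf df] := af; have [cg dg] := ag; split=> [a b ab|].
  have [M M0 HM] := acd_bounded a b af.
  have [N N0 HN] := acd_bounded a b ag.
  apply: (abs_cont_dom (cf _ _ ab) (cg _ _ ab) (K := M + N)) => x y ax xy yb.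
  rewrite (_ : _ - _ = (f y - f x) * g y + f x * (g y - g x)); last by ring.
  apply: le_trans (ler_normD _ _) _; rewrite !normrM.
  have := HM x ax (le_trans xy yb); have := HN y (le_trans ax xy) yb.
  have := normr_ge0 (f y - f x); have := normr_ge0 (g y - g x).
  by nra.
apply: (@filterS2 _ _ (ae_filter_ringOfSetsType mu) _ _ _ _ df dg).
move=> x fx gx; have := is_deriveM fx gx.
by congr is_derive; rewrite /GRing.scale/= addrC (mulrC (g x)).
Qed.

Lemma acdZ (c : R) f f' : acd f f' -> acd (fun x => c * f x) (fun x => c * f' x).
Proof.
move=> af; have := acdM (acd_cst c) af.
by congr acd; apply/funext => x; rewrite mul0r add0r.
Qed.

Lemma acdN f f' : acd f f' -> acd (fun x => - f x) (fun x => - f' x).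
Proof.
move=> /(acdZ (-1)); congr acd; apply/funext => x; by rewrite mulN1r.
Qed.

Lemma acdB f f' g g' : acd f f' -> acd g g' ->
  acd (fun x => f x - g x) (fun x => f' x - g' x).
Proof. by move=> af /acdN; exact: acdD. Qed.

(** On [[a, b]] the function [f] stays in a compact interval, where the mean value theorem makes the
    continuously differentiable [phi] Lipschitz. *)
Lemma acd_comp (phi phi' : R -> R) f f' :
  (forall x : R, is_derive x 1 phi (phi' x)) -> continuous phi' -> acd f f' ->
  acd (fun x => phi (f x)) (fun x => phi' (f x) * f' x).
Proof.
move=> dphi cphi' af; have [cf df] := af; split=> [a b ab|].
  have [M M0 HM] := acd_bounded a b af.
  have [N N0 HN] := continuous_bounded (- M) M cphi'.
  have cphi : continuous phi.
    move=> x; apply/differentiable_continuous/derivable1_diffP.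
    by have [] := dphi x.
  have lip (u v : R) : - M <= u -> u <= v -> v <= M -> `|phi v - phi u| <= N * `|v - u|.
    move=> Mu uv vM.
    have [c] := @MVT_segment _ phi phi' u v uv (fun x _ => dphi x)
      (continuous_subspaceT cphi).
    rewrite in_itv/= => /andP[uc cv] ->; rewrite normrM ler_wpM2r// HN//.
      exact: le_trans uc.
    exact: le_trans vM.
  apply: (abs_cont_dom (cf _ _ ab) (cf _ _ ab) (K := N)) => x y ax xy yb.
  have /ler_normlP[fx1 fx2] := HM x ax (le_trans xy yb).
  have /ler_normlP[fy1 fy2] := HM y (le_trans ax xy) yb.
  apply: (@le_trans _ _ (N * `|f y - f x|)).
    case: (leP (f x) (f y)) => [fxy|/ltW fxy]; first by apply: lip => //; lra.
    by rewrite distrC (distrC (f y)); apply: lip => //; lra.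
  by rewrite ler_wpM2l// lerDl.
apply: (@filterS _ _ (ae_filter_ringOfSetsType mu) _ _ _ df) => x fx.
exact: (is_derive1_comp (dphi (f x)) fx).
Qed.

Lemma acd_expR f f' : acd f f' ->
  acd (fun x => expR (f x)) (fun x => expR (f x) * f' x).
Proof.
apply: (@acd_comp expR expR).
exact: continuous_expR.
Qed.

Lemma acd_cos f f' : acd f f' ->
  acd (fun x => cos (f x)) (fun x => - sin (f x) * f' x).
Proof.
apply: (@acd_comp cos (fun x => - sin x)).
by move=> x; apply: continuousN; exact: continuous_sin.
Qed.

Lemma acd_sin f f' : acd f f' ->
  acd (fun x => sin (f x)) (fun x => cos (f x) * f' x).
Proof.
apply: (@acd_comp sin cos).
exact: continuous_cos.
Qed.

Lemma acd_le f f' g g' a b : a <= b -> acd f f' -> acd g g' ->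
  {ae mu, forall x, a <= x <= b -> f' x <= g' x} -> f b - f a <= g b - g a.
Proof.
move=> ab af ag fg.
suff : f b - g b <= f a - g a by lra.
apply: (@acd_le0 (fun x => f x - g x) (fun x => f' x - g' x)) => //.
  exact: acdB.
apply: (@filterS _ _ (ae_filter_ringOfSetsType mu) _ _ _ fg) => x + xab.
by move=> /(_ xab); rewrite subr_le0.
Qed.

(** * Locally integrable functions and their primitives *)

Definition locint f := forall a b, mu.-integrable `[a, b] (EFin \o f).

Lemma locint_subset f (D : set R) a b : locint f -> measurable D ->
  D `<=` `[a, b] -> mu.-integrable D (EFin \o f).
Proof. by move=> If mD Dab; exact: integrableS (If a b). Qed.

(** Half-open intervals are used so that neighbours sharing an end point are still disjoint. *)
Lemma sum_Rintegral_le f (s : seq (R * R)) (D : set R) :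
  measurable D -> mu.-integrable D (EFin \o f) -> (forall x, 0 <= f x) ->
  (forall p, p \in s -> `]p.1, p.2] `<=` D) ->
  pairwise (fun p p' => (p.2 <= p'.1) || (p'.2 <= p.1)) s ->
  \sum_(p <- s) \int[mu]_(x in `]p.1, p.2]) f x <= \int[mu]_(x in D) f x.
Proof.
move=> + + f0; elim: s D => [|p s ih] D mD iD sD /= psep.
  by rewrite big_nil Rintegral_ge0.
have /andP[/allP p1 s1] := psep.
have pD : `]p.1, p.2] `<=` D by apply: sD; rewrite mem_head.
have mDp : measurable (D `\` `]p.1, p.2]) by exact: measurableD.
have De : D = `]p.1, p.2] `|` (D `\` `]p.1, p.2]) by rewrite setDUK.
rewrite big_cons [in leRHS]De Rintegral_setU//; first last.
- by apply/disj_setPS => x [xp [_]].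
- by rewrite -De.
rewrite lerD2l ih//; first by apply: integrableS iD => //; exact: subDsetl.
move=> q qs x xq; split; first by apply: (sD q) => //; rewrite inE qs orbT.
move=> xp; have /orP[] := p1 q qs; move: xq xp; rewrite /= !in_itv/=; lra.
Qed.

Lemma Rintegral_itv_cst (c : R) a b : a <= b ->
  \int[mu]_(x in `[a, b]) c = c * (b - a).
Proof.
move=> ab; rewrite Rintegral_cst//; congr (_ * _).
rewrite /= lebesgue_measure_itv/= lte_fin.
by case: ltP => // ba; apply/esym/eqP; rewrite subr_eq0 eq_le ba ab.
Qed.

Lemma Rintegral_itv_cat f a x b : locint f -> a <= x -> x <= b ->
  \int[mu]_(t in `[a, b]) f t =
  \int[mu]_(t in `[a, x]) f t + \int[mu]_(t in `[x, b]) f t.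
Proof.
move=> If ax xb; have := @Rintegral_itvB _ f (BLeft a) (BRight b) x (If _ _).
rewrite !bnd_simp => /(_ ax xb) H.
rewrite -(@Rintegral_itv_obnd_cbnd _ x (BRight b) f); last first.
  by apply: (locint_subset If (a := x) (b := b)) => // y /=; rewrite !in_itv/=; lra.
by rewrite -H; ring.
Qed.

Lemma ointB f c x y : locint f -> x <= y ->
  oint f c y - oint f c x = \int[mu]_(t in `[x, y]) f t.
Proof.
move=> If xy; rewrite /oint; case: (leP c y) => cy; case: (leP c x) => cx.
- by rewrite (Rintegral_itv_cat If cx xy); ring.
- by rewrite (Rintegral_itv_cat If (ltW cx) cy); ring.
- by move: (le_trans cx xy); rewrite leNgt cy.
- by rewrite (Rintegral_itv_cat If xy (ltW cy)); ring.
Qed.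

Lemma oint_refl f c : oint f c c = 0.
Proof. by rewrite /oint lexx set_itv1 Rintegral_set1. Qed.

Lemma lebesgue_measure_segment_lty a b : (mu `[a, b] < +oo)%E.
Proof.
by rewrite /= lebesgue_measure_itv/=; case: ifPn; rewrite ?ltry// -EFinB ltry.
Qed.

(** Write [f] as a continuous function, bounded by [M] on [[a, b]], plus a remainder of mean below
    [e / 2]. The bounded part contributes at most [M] times the total length, and the remainder at
    most its integral over all of [[a, b]], however many intervals there are. *)
Lemma abs_cont_oint f c a b : locint f -> abs_cont a b (oint f c).
Proof.
move=> If e e0.
have mfin := lebesgue_measure_segment_lty a b.
have e20 : 0 < e / 2 by rewrite divr_gt0.
have [h [ch ih /fine_cvgP[_ /cvgrPdist_lt/(_ _ e20)[N _ /(_ N (leqnn _))]]]] :=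
  approximation_continuous_integrable (measurable_itv `[a, b]) mfin (If a b).
rewrite /= sub0r normrN => hN.
pose k (x : R) : R := `|f x - h N x|.
have ik : mu.-integrable `[a, b] (EFin \o k).
  apply: (@integrable_norm _ _ _ mu _ (fun x => f x - h N x)).
  exact: (integrableB _ (If a b) (ih N)).
have {}hN : \int[mu]_(x in `[a, b]) k x < e / 2.
  exact: le_lt_trans (ler_norm _) hN.
have [M M0 HM] := continuous_bounded a b (ch N).
have M1 : 0 < M + 1 by lra.
(* The bound [M] may be zero, hence [M + 1]. *)
exists (e / 2 / (M + 1)) => [|s sab sd sl]; first exact: divr_gt0.
apply: (@le_lt_trans _ _ (M * (\sum_(p <- s) (p.2 - p.1)) +
    \sum_(p <- s) \int[mu]_(x in `]p.1, p.2]) k x)); last first.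
  have sk : \sum_(p <- s) \int[mu]_(x in `]p.1, p.2]) k x <= \int[mu]_(x in `[a, b]) k x.
    apply: sum_Rintegral_le => // [x|p /(allP sab)/and3P[ap p12 pb] x /=].
      exact: normr_ge0.
    by rewrite !in_itv/=; lra.
  have sl0 : 0 <= \sum_(p <- s) (p.2 - p.1).
    rewrite big_seq sumr_ge0// => p /(allP sab)/and3P[_ p12 _].
    by rewrite subr_ge0.
  have : (\sum_(p <- s) (p.2 - p.1)) * (M + 1) < e / 2 by rewrite -ltr_pdivlMr.
  move: sk sl0 hN; set S1 := \sum_(p <- s) (p.2 - p.1).
  set S2 := \sum_(p <- s) _; set S3 := Rintegral _ _ _.
  by clearbody S1 S2 S3; clear -M0; lra.
rewrite mulr_sumr -big_split/= big_seq [leRHS]big_seq ler_sum// => p.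
move=> /(allP sab)/and3P[ap p12 pb].
have sub : `[p.1, p.2] `<=` `[a, b] by move=> x /=; rewrite !in_itv/=; lra.
have ikp : mu.-integrable `[p.1, p.2] (EFin \o k) by exact: integrableS ik.
have iM : mu.-integrable `[p.1, p.2] (EFin \o (fun=> M)).
  have cM : continuous (fun _ : R => M : R) by move=> ?; exact: cvg_cst.
  apply: continuous_compact_integrable; first exact: segment_compact.
  exact: continuous_subspaceT.
rewrite ointB//; apply: (le_trans (le_normr_Rintegral _ _)) => //.
rewrite Rintegral_itv_obnd_cbnd; last first.
  by apply: integrableS ikp => // x /=; rewrite !in_itv/=; lra.
have -> : M * (p.2 - p.1) = \int[mu]_(x in `[p.1, p.2]) M.
  by rewrite Rintegral_itv_cst.
rewrite -RintegralD//; apply: le_Rintegral => //.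
- exact: integrable_norm (If _ _).
- exact: (integrableD _ iM ikp).
- move=> x /sub/=; rewrite in_itv/= => /andP[ax xb].
  rewrite (_ : f x = h N x + (f x - h N x)); last by ring.
  by apply: le_trans (ler_normD _ _) _; rewrite lerD2r HM.
Qed.


Lemma locint_measurable f : locint f -> measurable_fun [set: R] f.
Proof.
move=> If; have -> : [set: R] = \bigcup_(n : nat) [set` `[- n%:R, n%:R]].
  apply/seteqP; split => // x _; exists (Num.truncn `|x|).+1 => //=.
  rewrite in_itv/= -ler_norml.
  exact/ltW/truncnS_gt.
apply/measurable_fun_bigcup => // n.
by have /integrableP[/measurable_EFinP] := If (- n%:R) n%:R.
Qed.

Lemma locint_locally_integrable f : locint f -> locally_integrable [set: R] f.
Proof.
move=> If; split; [exact: locint_measurable|exact: openT|move=> K _ cK].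
have [M [_ HM]] := compact_bounded cK.
have KM : K `<=` `[- (`|M| + 1), `|M| + 1].
  move=> x Kx /=; rewrite in_itv/= -ler_norml.
  by apply: HM => //; apply: (le_lt_trans (ler_norm M)); rewrite ltrDl.
have mK : measurable K by exact: compact_measurable.
by have /integrableP[] := locint_subset If mK KM.
Qed.

(** Lebesgue differentiation is available for integrals with a fixed left end, so the base points
    [-n] are used. Countably many null sets are discarded, and for [n] beyond [|x| + |c|] the
    oriented integral differs from the one based at [-n] by a constant near [x]. *)
Lemma acd_oint f c : locint f -> acd (oint f c) f.
Proof.
move=> If; split=> [a b _|]; first exact: abs_cont_oint.
pose F (n : nat) (y : R) : R := \int[mu]_(t in `[- n%:R, y]) f t.
have : {ae mu, forall x : R, forall n : nat, - n%:R < x ->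
    derivable (F n) x 1 /\ derive1 (F n) x = f x}.
  apply: ae_foralln => n.
  have := @FTC1 R f (BLeft (- n%:R)) (fun y => If _ _) (locint_locally_integrable If).
  apply: (@filterS _ _ (ae_filter_ringOfSetsType mu)) => x.
  by move=> H nx; refine (H _); rewrite /= lte_fin.
apply: (@filterS _ _ (ae_filter_ringOfSetsType mu)) => x.
move=> /(_ (Num.truncn (`|x| + `|c|)).+1); set n := _.+1.
have : `|x| + `|c| < n%:R by exact: truncnS_gt.
have := ler_norm (- x); have := ler_norm (- c); rewrite !normrN.
have := normr_ge0 x; have := normr_ge0 c => c0 x0 cN xN nxc.
move=> /(_ _)[|dF]; first by lra.
rewrite derive1E => eF.
have Fc y : - n%:R <= y -> oint f c y = F n y - F n c.
  move=> ny; rewrite /F -(ointB c If ny) -(ointB c If); last by lra.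
  by rewrite oint_refl; ring.
apply: (@near_eq_is_derive _ _ _ (fun y => F n y - F n c)).
  have nx : - n%:R < x by lra.
  near=> y; rewrite Fc//; near: y.
  exact: (lt_le_nbhsr nx).
rewrite -[f x]subr0; apply: is_deriveB.
by rewrite -eF; exact: derivableP.
Unshelve. all: by end_near. Qed.

(** * Translation, reflection and periodicity *)

Lemma lebesgue_measure_shift (c : R) (A : set R) : measurable A ->
  pushforward mu (fun x : R => (x + c : measurableTypeR R)) A = mu A.
Proof.
have mc : measurable_fun [set: R] (fun x : R => x + c) by exact: measurable_funD.
move=> mA; apply/esym/lebesgue_measure_unique => //= _ [[a b]] _ <-.
rewrite /pushforward (_ : _ @^-1` _ = `]a - c, b - c]%classic); last first.
  by apply/seteqP; split => x /=; rewrite !in_itv/=; lra.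
rewrite /= !lebesgue_measure_itv/= !lte_fin ltrD2r.
by case: ifP => // _; congr EFin; lra.
Qed.

Section measure_preserving.
Variable phi : R -> R.
Hypothesis mphi : measurable_fun [set: R] phi.
Hypothesis phiE : forall A : set R, measurable A ->
  pushforward mu (phi : R -> measurableTypeR R) A = mu A.

Lemma ae_preserving (P : R -> Prop) : {ae mu, forall x, P x} ->
  {ae mu, forall x, P (phi x)}.
Proof.
move=> [A [mA A0 PA]]; exists (phi @^-1` A); split.
- by rewrite -[X in measurable X]setTI; exact: mphi.
- by rewrite -A0; exact: phiE.
- by move=> x /= Px; exact: PA.
Qed.

Lemma integrable_preserving (D : set R) (f : R -> R) : measurable D ->
  mu.-integrable D (EFin \o f) -> mu.-integrable (phi @^-1` D) (EFin \o (f \o phi)).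
Proof.
move=> mD /integrableP[mf foo]; apply/integrableP; split.
  by apply: (measurable_comp mD _ mf (measurable_funTS mphi)) => _ [x Dx <-].
have mf' : measurable_fun D (fun x => `|(EFin \o f) x|%E) by exact: measurableT_comp.
have := @ge0_integral_pushforward _ _ (measurableTypeR R) (measurableTypeR R)
  R phi mphi mu D _ mD mf' (fun y _ => abse_ge0 _) => <-.
by rewrite (eq_measure_integral mu)// => A mA _; exact: phiE.
Qed.

End measure_preserving.

Lemma opp_itv (a b : R) : -%R @^-1` `[- b, - a] = `[a, b]%classic.
Proof. by apply/seteqP; split => x /=; rewrite !in_itv/= !lerN2 andbC. Qed.

Lemma measurable_shift (c : R) : measurable_fun [set: R] (fun x : R => x + c).
Proof. exact: measurable_funD. Qed.

Lemma measurable_opp : measurable_fun [set: R] (-%R : R -> R).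
Proof. exact: measurable_funN. Qed.

Lemma locint_opp f : locint f -> locint (fun x => f (- x)).
Proof.
move=> If a b; rewrite -(opp_itv a b).
apply: (integrable_preserving measurable_opp (@lebesgue_measureN R)) => //.
Qed.

Lemma acd_shift f g c : acd f g -> acd (fun x => f (x + c)) (fun x => g (x + c)).
Proof.
move=> [cf df]; split=> [a b ab e e0|].
  have [|d d0 H] := cf (a + c) (b + c) _ e e0; first by rewrite lerD2r.
  exists d => // s sab sd sl.
  have := H [seq (p.1 + c, p.2 + c) | p <- s].
  rewrite all_map pairwise_map !big_map/=; apply.
  - by apply: sub_all sab => p /=; rewrite !lerD2r.
  - by apply: sub_pairwise sd => p q /=; rewrite !lerD2r.
  - by rewrite (eq_bigr (fun p => p.2 - p.1)) // => p _; ring.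
have := ae_preserving (measurable_shift c) (lebesgue_measure_shift c) df.
apply: (@filterS _ _ (ae_filter_ringOfSetsType mu)) => x fx.
have := @is_derive1_comp R f (fun x => x + c) x (g (x + c)) 1 fx.
rewrite mulr1; apply.
have H : is_derive (x : R) (1 : R) (fun x : R => x + c) (1 + 0) by exact: is_deriveD.
by rewrite addr0 in H.
Qed.

Lemma acd_opp f g : acd f g -> acd (fun x => f (- x)) (fun x => - g (- x)).
Proof.
move=> [cf df]; split=> [a b ab e e0|].
  have [|d d0 H] := cf (- b) (- a) _ e e0; first by rewrite lerN2.
  exists d => // s sab sd sl.
  have := H [seq (- p.2, - p.1) | p <- s].
  rewrite all_map pairwise_map !big_map/=.
  move=> {}H; rewrite (eq_bigr (fun p => `|f (- p.1) - f (- p.2)|)); last first.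
    by move=> p _; rewrite distrC.
  apply: H.
  - by apply: sub_all sab => p /=; rewrite !lerN2 => /and3P[-> -> ->].
  - by apply: sub_pairwise sd => p q /=; rewrite !lerN2 orbC.
  - by rewrite (eq_bigr (fun p => p.2 - p.1)) // => p _; ring.
have := ae_preserving measurable_opp (@lebesgue_measureN R) df.
apply: (@filterS _ _ (ae_filter_ringOfSetsType mu)) => x fx.
have := @is_derive1_comp R f -%R x (g (- x)) (-1) fx.
by rewrite mulrN1; apply; apply: is_deriveN.
Qed.

Lemma integrableU (A B : set R) f : measurable A -> measurable B ->
  mu.-integrable A (EFin \o f) -> mu.-integrable B (EFin \o f) ->
  mu.-integrable (A `|` B) (EFin \o f).
Proof.
move=> mA mB /integrableP[mfA fA] /integrableP[mfB fB].
have mfAB : measurable_fun (A `|` B) (EFin \o f) by apply/measurable_funU.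
apply/integrableP; split => //.
have mBA : measurable (B `\` A) by exact: measurableD.
have ABE : A `|` B = A `|` (B `\` A).
  apply/seteqP; split=> x; last by case=> [|[]]; [left|right].
  by have [xA|xA] := pselect (A x); [left|case=> [//|xB]; right].
have mfa : measurable_fun (A `|` B) (fun x => `|(EFin \o f) x|%E).
  exact: measurableT_comp.
rewrite ABE ge0_integral_setU//; last 2 first.
- by rewrite -ABE.
- by apply/disj_setPS => x [xA [_]].
rewrite lte_add_pinfty//; apply: le_lt_trans fB.
by apply: ge0_subset_integral => //; exact: measurableT_comp.
Qed.

(** Half-open translates of one period tile the line; each induction step glues one tile to either
    end, and every bounded interval is covered after finitely many steps. *)
Lemma locint_periodic f (T : R) : 0 < T -> mu.-integrable `[0, T[ (EFin \o f) ->
  (forall t, f (t + T) = f t) -> locint f.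
Proof.
move=> T0 I0 fT.
have fnT (n : nat) t : f (t + n%:R * T) = f t.
  elim: n => [|n ih]; first by rewrite mul0r addr0.
  by rewrite -natr1 mulrDl mul1r addrA fT.
have tile (c : R) : (forall t, f (t + c) = f t) ->
    mu.-integrable `[- c, T - c[ (EFin \o f).
  move=> fc; have -> : EFin \o f = EFin \o (f \o (fun t => t + c)).
    by apply/funext => t /=; rewrite fc.
  rewrite (_ : `[- c, T - c[%classic = (fun t => t + c) @^-1` `[0, T[); last first.
    by apply/seteqP; split => x /=; rewrite !in_itv/=; lra.
  by apply: (integrable_preserving (measurable_shift c) (lebesgue_measure_shift c)).
have main (n : nat) : mu.-integrable `[- (n%:R * T), n%:R * T[ (EFin \o f).
  elim: n => [|n ih].
    by rewrite mul0r oppr0 set_itvco0; exact: integrable_set0.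
  have nT : 0 <= n%:R * T by rewrite mulr_ge0// ltW.
  have -> : `[- (n.+1%:R * T), n.+1%:R * T[%classic =
      `[- (n.+1%:R * T), T - n.+1%:R * T[ `|` `[- (n%:R * T), n%:R * T[
      `|` `[- (- (n%:R * T)), T - (- (n%:R * T))[ :> set R.
    rewrite -natr1; apply/seteqP; split => x /=; rewrite !in_itv/=; last first.
      by move=> [[]|] /andP[]; lra.
    move=> /andP[x1 x2]; case: (ltP x (- (n%:R * T))) => xn; first by left; left; lra.
    by case: (ltP x (n%:R * T)) => xn'; [left; right; lra|right; lra].
  apply: integrableU; [exact: measurableU|by []| |].
    by apply: integrableU => //; apply: tile => t; exact: fnT.
  by apply: tile => t; rewrite -[LHS](fnT n); congr f; ring.
move=> a b; pose M : R := `|a| + `|b|.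
pose n := (Num.truncn (M / T)).+1.
have MnT : M < n%:R * T by rewrite -ltr_pdivrMr//; exact: truncnS_gt.
apply: integrableS (main n) => // x /=; rewrite !in_itv/= => /andP[ax xb].
have := ler_norm b; have := ler_norm (- a); rewrite normrN.
have := normr_ge0 a; have := normr_ge0 b; move: MnT; rewrite /M.
by move: (n%:R * T) => m; lra.
Qed.

(** * Closure properties of local integrability and approximation in mean *)

Lemma locint_continuous f : continuous f -> locint f.
Proof.
move=> cf a b; apply: continuous_compact_integrable; first exact: segment_compact.
exact: continuous_subspaceT.
Qed.

Lemma locintD f g : locint f -> locint g -> locint (fun x => f x + g x).
Proof. by move=> If Ig a b; exact: (integrableD _ (If a b) (Ig a b)). Qed.

Lemma locintN f : locint f -> locint (fun x => - f x).
Proof. by move=> If a b; exact: integrableN (If a b). Qed.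

Lemma locintB f g : locint f -> locint g -> locint (fun x => f x - g x).
Proof. by move=> If Ig; exact/locintD/locintN. Qed.

Lemma locintM f g : continuous f -> locint g -> locint (fun x => f x * g x).
Proof.
move=> cf Ig a b.
have [M M0 HM] := continuous_bounded a b cf.
apply: (integrableMr _ _ _ (Ig a b)) => //.
  apply: subspace_continuous_measurable_fun => //.
  exact: continuous_subspaceT.
exists M; split; first exact: num_real.
move=> y My x /=; rewrite in_itv/= => /andP[ax xb].
exact: le_trans (HM _ ax xb) (ltW My).
Qed.

Lemma locintZ (c : R) g : locint g -> locint (fun x => c * g x).
Proof. by apply: locintM => x; exact: cvg_cst. Qed.

Lemma locint_norm f : locint f -> locint (fun x => `|f x|).
Proof. by move=> If a b; exact: integrable_norm (If a b). Qed.

(** Uniform continuity in which only the base point is confined to [[a, b]]: the moving average at a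
    point near [b] looks beyond [b]. *)
Lemma continuous_unif_itv h a b e : continuous h -> 0 < e ->
  exists2 d : R, 0 < d & forall x y, a <= x <= b -> 0 <= y < d ->
    `|h (x + y) - h x| <= e.
Proof.
move=> ch e0; have e20 : 0 < e / 2 by rewrite divr_gt0.
have /compact_near_coveringP := @segment_compact R a b.
move=> /(_ R (nbhs (0 : R)) (fun y x => `|h (x + y) - h x| <= e) _)[x _|d /= d0 H].
  have /cvgrPdist_lt/(_ _ e20) := ch x.
  move=> /nbhs_ballP[r /= r0 Hr].
  exists (ball x (r / 2), ball 0 (r / 2)) => /=.
    by split; apply: nbhsx_ballx; rewrite divr_gt0.
  move=> [x' y] [/= xx' yy].
  have h1 : `|h x - h x'| < e / 2.
    by apply: Hr; apply: le_ball xx'; rewrite ler_pdivrMr// ler_peMr ?ltW// ltr1n.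
  have h2 : `|h x - h (x' + y)| < e / 2.
    apply: Hr; rewrite /ball/=; move: xx' yy; rewrite /ball/= sub0r normrN => xx' yy.
    rewrite (_ : x - (x' + y) = (x - x') - y); last by ring.
    by apply: le_lt_trans (ler_normB _ _) _; lra.
  rewrite (_ : h (x' + y) - h x' = (h x - h x') - (h x - h (x' + y))); last by ring.
  by apply: le_trans (ler_normB _ _) _; lra.
exists d => // x y xab /andP[y0 yd].
by apply: H => //=; rewrite sub0r normrN ger0_norm.
Qed.

(** Integration by parts calls for an approximant with bounded derivative. A moving average has one:
    its derivative is an increment of the averaged function divided by the window length. *)
Lemma L1_approx f (T e : R) : locint f -> 0 < T -> 0 < e ->
  exists L L' : R -> R, [/\ acd L L', locint L',
    exists2 M : R, 0 <= M & forall x, 0 <= x <= T -> `|L' x| <= M &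
    \int[mu]_(x in `[0, T]) `|f x - L x| <= e].
Proof.
move=> If T0 e0; have e20 : 0 < e / 2 by rewrite divr_gt0.
have mfin := lebesgue_measure_segment_lty 0 T.
have [h_ [ch_ ih_ /fine_cvgP[_ /cvgrPdist_lt/(_ _ e20)[N _ /(_ N (leqnn _))]]]] :=
  approximation_continuous_integrable (measurable_itv `[0, T]) mfin (If 0 T).
rewrite /= sub0r normrN; set h := h_ N; have ch : continuous h := ch_ N.
move=> hN; have {}hN : \int[mu]_(x in `[0, T]) `|f x - h x| < e / 2.
  exact: le_lt_trans (ler_norm _) hN.
have e'0 : 0 < e / 2 / T by rewrite divr_gt0.
have [d d0 Hd] := continuous_unif_itv 0 T ch e'0.
(* [f] is close to the continuous [h], hence to the moving average [L] of [h]. *)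
pose n : R := d / 2; have n0 : 0 < n by rewrite divr_gt0.
have Ih := locint_continuous ch.
have Gd := acd_oint 0 Ih; set G := oint h 0 in Gd.
pose L x := n^-1 * (G (x + n) - G x); pose L' x := n^-1 * (h (x + n) - h x).
have ch' : continuous (fun x => h (x + n)).
  move=> x; apply: (@continuous_comp _ _ _ (fun x => x + n) h); last exact: ch.
  by apply: continuousD; [exact: cvg_id|exact: cvg_cst].
have cL' : continuous L'.
  move=> x; apply: cvgM; first exact: cvg_cst.
  by apply: cvgB; [exact: ch'|exact: ch].
have aL : acd L L' by apply: acdZ; apply: acdB => //; exact: acd_shift.
exists L, L'; split => //; first exact: locint_continuous.
  have [M M0 HM] := continuous_bounded 0 T cL'.
  by exists M => // x /andP[x0 xT]; exact: HM.
have Lh x : 0 <= x <= T -> `|L x - h x| <= e / 2 / T.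
  move=> xT; have xn : x <= x + n by rewrite lerDl ltW.
  have near t : x <= t <= x + n -> `|h t - h x| <= e / 2 / T.
    move=> /andP[xt tn]; have := Hd x (t - x) xT; rewrite [x + _]addrC subrK; apply.
    by rewrite subr_ge0 xt/=; move: tn; rewrite /n; lra.
  have up : G (x + n) - G x <= (h x + e / 2 / T) * (x + n) - (h x + e / 2 / T) * x.
    apply: (@acd_le G h (fun t => (h x + e / 2 / T) * t)
      (fun t => (h x + e / 2 / T) * 1)) => //.
      by apply: acdZ; exact: acd_id.
    by apply: aeW => t /near /ler_normlP[_]; lra.
  have lo : (h x - e / 2 / T) * (x + n) - (h x - e / 2 / T) * x <= G (x + n) - G x.
    apply: (@acd_le (fun t => (h x - e / 2 / T) * t)
      (fun t => (h x - e / 2 / T) * 1) G h) => //.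
      by apply: acdZ; exact: acd_id.
    by apply: aeW => t /near /ler_normlP[+ _]; lra.
  rewrite (_ : L x - h x = (G (x + n) - G x - h x * n) / n); last first.
    by rewrite /L; field; rewrite gt_eqF.
  rewrite normrM normfV (gtr0_norm n0) ler_pdivrMr// ler_norml; apply/andP; split; lra.
have IL := locint_continuous (acd_continuous aL).
have -> : e = e / 2 + e / 2 / T * (T - 0) by field; rewrite gt_eqF.
rewrite -(Rintegral_itv_cst _ (ltW T0)).
have Ic : locint (fun=> e / 2 / T) by apply: locint_continuous => x; exact: cvg_cst.
have Ifh := locint_norm (locintB If Ih).
have IfL := locint_norm (locintB If IL).
apply: (@le_trans _ _ (\int[mu]_(x in `[0, T]) (`|f x - h x| + e / 2 / T))).
  apply: le_Rintegral => //; first exact: (locintD Ifh Ic).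
  move=> x /=; rewrite in_itv/= => /Lh xT.
  rewrite (_ : f x - L x = (f x - h x) - (L x - h x)); last by ring.
  by apply: le_trans (ler_normB _ _) _; rewrite lerD2l.
by rewrite RintegralD// lerD2r ltW.
Qed.

End absolute_continuity.

(** * Complex-valued functions *)

Section complex_facts.
Context {R : realType}.
Local Notation C := R[i].
Local Notation Re := complex.Re.
Local Notation Im := complex.Im.
Local Notation normc := Normc.normc.
Implicit Types (x y z : C).

Lemma ReD x y : Re (x + y) = Re x + Re y. Proof. by case: x; case: y. Qed.
Lemma ImD x y : Im (x + y) = Im x + Im y. Proof. by case: x; case: y. Qed.
Lemma ReN x : Re (- x) = - Re x. Proof. by case: x. Qed.
Lemma ImN x : Im (- x) = - Im x. Proof. by case: x. Qed.
Lemma ReM x y : Re (x * y) = Re x * Re y - Im x * Im y.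
Proof. by case: x; case: y. Qed.
Lemma ImM x y : Im (x * y) = Re x * Im y + Im x * Re y.
Proof. by case: x; case: y. Qed.

Definition ReImE := (ReD, ImD, ReN, ImN, ReM, ImM).

Lemma complexP x y : Re x = Re y -> Im x = Im y -> x = y.
Proof. by case: x; case: y => a b c d /= -> ->. Qed.

Lemma sqr_normc z : normc z ^+ 2 = Re z ^+ 2 + Im z ^+ 2.
Proof. by case: z => a b /=; rewrite sqr_sqrtr// addr_ge0// sqr_ge0. Qed.

Lemma normc_ge0 z : 0 <= normc z.
Proof. by case: z => a b /=; exact: sqrtr_ge0. Qed.

Lemma normcN z : normc (- z) = normc z.
Proof. by case: z => a b /=; rewrite !sqrrN. Qed.

Lemma le_normcB x y : normc (x - y) <= normc x + normc y.
Proof. by apply: le_trans (le_normcD _ _) _; rewrite normcN. Qed.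

Lemma normcC (a : R) : normc a%:C%C = `|a|.
Proof. by rewrite /= expr0n addr0 sqrtr_sqr. Qed.

Lemma Re_le_normc z : Re z <= normc z.
Proof.
rewrite (le_trans (ler_norm _))// -(ler_pXn2r (n := 2))// ?nnegrE ?normc_ge0//.
by rewrite sqr_normc real_normK ?num_real// lerDl sqr_ge0.
Qed.

Lemma normRe_le_normc z : `|Re z| <= normc z.
Proof.
by rewrite ler_norml Re_le_normc andbT lerNl -ReN -(normcN z) Re_le_normc.
Qed.

(** A majorant of the modulus whose local integrability follows at once from that of the real and
    imaginary parts. *)
Definition norm1c z : R := `|Re z| + `|Im z|.

Lemma norm1c_ge0 z : 0 <= norm1c z.
Proof. exact: addr_ge0. Qed.

Lemma normc_le_norm1c z : normc z <= norm1c z.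
Proof.
rewrite -(ler_pXn2r (n := 2))// ?nnegrE ?normc_ge0 ?norm1c_ge0// sqr_normc.
rewrite sqrrD !real_normK ?num_real// -addrA lerD2l lerDr.
by rewrite mulrn_wge0// mulr_ge0.
Qed.

(** The complex exponential in polar form, convenient for derivatives and moduli; [cvg_exp_series]
    identifies it with the power series. *)
Definition cexp z : C :=
  Complex (expR (Re z) * cos (Im z)) (expR (Re z) * sin (Im z)).

Lemma cexpD x y : cexp (x + y) = cexp x * cexp y.
Proof.
by rewrite /cexp !ReImE expRD cosD sinD; apply: complexP => /=; ring.
Qed.

Lemma cexp0 : cexp 0 = 1.
Proof. by rewrite /cexp/= expR0 cos0 sin0 mulr1 mulr0. Qed.

Lemma cexpN z : cexp (- z) * cexp z = 1.
Proof. by rewrite -cexpD addNr cexp0. Qed.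

Lemma normc_cexp z : normc (cexp z) = expR (Re z).
Proof.
apply: (@pexpIrn _ 2) => //; rewrite ?nnegrE ?normc_ge0 ?expR_ge0// sqr_normc /=.
by rewrite !exprMn -mulrDr cos2Dsin2 mulr1.
Qed.

End complex_facts.

Section complex_absolute_continuity.
Context {R : realType}.
Local Notation C := R[i].
Local Notation Re := complex.Re.
Local Notation Im := complex.Im.
Local Notation normc := Normc.normc.
Local Notation mu := (@lebesgue_measure R).
Implicit Types (f g : R -> C) (a b : R).

Definition cacd f g := acd (fun t => Re (f t)) (fun t => Re (g t)) /\
  acd (fun t => Im (f t)) (fun t => Im (g t)).

Definition clocint f := locint (fun t => Re (f t)) /\ locint (fun t => Im (f t)).

Definition ccontinuous f :=
  continuous (fun t => Re (f t)) /\ continuous (fun t => Im (f t)).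

Lemma acd_ext (f g f' g' : R -> R) :
  acd f g -> f =1 f' -> g =1 g' -> acd f' g'.
Proof. by move=> + /funext <- /funext <-. Qed.

Lemma locint_ext (f f' : R -> R) : locint f -> f =1 f' -> locint f'.
Proof. by move=> + /funext <-. Qed.

Lemma cacd_ext f g f' g' : cacd f g -> f =1 f' -> g =1 g' -> cacd f' g'.
Proof. by move=> + /funext <- /funext <-. Qed.

Lemma cacd_continuous f g : cacd f g -> ccontinuous f.
Proof. by move=> [/acd_continuous ? /acd_continuous]. Qed.

Lemma ccontinuous_bounded f a b : ccontinuous f ->
  exists2 M : R, 0 <= M & forall x, a <= x -> x <= b -> normc (f x) <= M.
Proof.
move=> [/(continuous_bounded a b)[M M0 HM] /(continuous_bounded a b)[N N0 HN]].
exists (M + N) => [|x ax xb]; first exact: addr_ge0.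
by apply: le_trans (normc_le_norm1c _) _; apply: lerD; [exact: HM|exact: HN].
Qed.

Lemma cacd_cst (c : C) : cacd (fun=> c) (fun=> 0).
Proof. by split; exact: acd_cst. Qed.

Lemma cacdD f f' g g' : cacd f f' -> cacd g g' ->
  cacd (fun x => f x + g x) (fun x => f' x + g' x).
Proof.
move=> [f1 f2] [g1 g2]; split.
  by apply: acd_ext (acdD f1 g1) _ _ => t; rewrite ReD.
by apply: acd_ext (acdD f2 g2) _ _ => t; rewrite ImD.
Qed.

Lemma cacdN f f' : cacd f f' -> cacd (fun x => - f x) (fun x => - f' x).
Proof.
move=> [f1 f2]; split.
  by apply: acd_ext (acdN f1) _ _ => t; rewrite ReN.
by apply: acd_ext (acdN f2) _ _ => t; rewrite ImN.
Qed.

Lemma cacdB f f' g g' : cacd f f' -> cacd g g' ->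
  cacd (fun x => f x - g x) (fun x => f' x - g' x).
Proof. by move=> af /cacdN; exact: cacdD. Qed.

Lemma cacdM f f' g g' : cacd f f' -> cacd g g' ->
  cacd (fun x => f x * g x) (fun x => f' x * g x + f x * g' x).
Proof.
move=> [f1 f2] [g1 g2]; split.
  apply: acd_ext (acdB (acdM f1 g1) (acdM f2 g2)) _ _ => t; rewrite !ReImE//; ring.
apply: acd_ext (acdD (acdM f1 g2) (acdM f2 g1)) _ _ => t; rewrite !ReImE//; ring.
Qed.

Lemma cacdZ (c : C) f f' : cacd f f' -> cacd (fun x => c * f x) (fun x => c * f' x).
Proof.
move=> af; apply: cacd_ext (cacdM (cacd_cst c) af) _ _ => // t; by rewrite mul0r add0r.
Qed.

Lemma cacd_linear (c : C) : cacd (fun t => c * t%:C%C) (fun=> c).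
Proof.
split.
  by apply: acd_ext (acdZ (Re c) (acd_id (R := R))) _ _ => t; rewrite ?ReImE/=; ring.
by apply: acd_ext (acdZ (Im c) (acd_id (R := R))) _ _ => t; rewrite ?ReImE/=; ring.
Qed.

Lemma cacd_exp f f' : cacd f f' ->
  cacd (fun x => cexp (f x)) (fun x => cexp (f x) * f' x).
Proof.
move=> [f1 f2]; split.
  by apply: acd_ext (acdM (acd_expR f1) (acd_cos f2)) _ _ => t; rewrite ?ReImE/=; ring.
by apply: acd_ext (acdM (acd_expR f1) (acd_sin f2)) _ _ => t; rewrite ?ReImE/=; ring.
Qed.

Lemma cacd_opp f f' : cacd f f' -> cacd (fun t => f (- t)) (fun t => - f' (- t)).
Proof.
move=> [/acd_opp f1 /acd_opp f2]; split; first by apply: acd_ext f1 _ _ => t; rewrite ?ReN.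
by apply: acd_ext f2 _ _ => t; rewrite ?ImN.
Qed.

Lemma cacd_shift (c : R) f f' : cacd f f' ->
  cacd (fun t => f (t + c)) (fun t => f' (t + c)).
Proof. by move=> [/(acd_shift c) f1 /(acd_shift c) f2]. Qed.

(** With [w = f b - f a] fixed, the real function [Re (conj w * f)] has derivative at most [|w| g']
    and increment [|w|^2]; the real comparison applies, and [|w|] is divided out. If [w = 0] it
    remains to see that [g] does not decrease, which holds as [g'] dominates a modulus. *)
Lemma cacd_le f f' (g g' : R -> R) a b : a <= b -> cacd f f' -> acd g g' ->
  {ae mu, forall x, a <= x <= b -> normc (f' x) <= g' x} ->
  normc (f b - f a) <= g b - g a.
Proof.
move=> ab [f1 f2] ag le; pose w := f b - f a.
have := acd_le ab (acdD (acdZ (Re w) f1) (acdZ (Im w) f2)) (acdZ (normc w) ag).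
have [w0|w0] := eqVneq (normc w) 0.
  move=> _; rewrite -/w w0.
  have := acd_le ab (acd_cst 0) ag; rewrite subrr; apply.
  apply: (@filterS _ _ (ae_filter_ringOfSetsType mu) _ _ _ le) => x + xab.
  by move=> /(_ xab); apply: le_trans; exact: normc_ge0.
have der_le : {ae mu, forall x, a <= x <= b ->
    Re w * Re (f' x) + Im w * Im (f' x) <= normc w * g' x}.
  apply: (@filterS _ _ (ae_filter_ringOfSetsType mu) _ _ _ le) => x + xab.
  move=> /(_ xab) H; apply: (@le_trans _ _ (normc w * normc (f' x))); last first.
    by rewrite ler_wpM2l ?normc_ge0.
  have -> : Re w * Re (f' x) + Im w * Im (f' x) = Re (conjc w * f' x).
    by rewrite ReM; case: w {w0} => p q /=; ring.
  apply: le_trans (Re_le_normc _) _; rewrite Normc.normcM ler_wpM2r ?normc_ge0//.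
  by case: w {w0} => p q /=; rewrite sqrrN.
move=> /(_ der_le) H.
have w1 : 0 < normc w by rewrite lt_def w0 normc_ge0.
rewrite -/w -(ler_pM2l w1) mulrBr -expr2 sqr_normc; apply: le_trans H.
by rewrite le_eqVlt; apply/orP; left; apply/eqP; rewrite /w !ReImE; ring.
Qed.

Definition coint g c t : C :=
  Complex (oint (fun s => Re (g s)) c t) (oint (fun s => Im (g s)) c t).

Lemma cacd_coint g c : clocint g -> cacd (coint g c) g.
Proof. by move=> [g1 g2]; split; exact: acd_oint. Qed.

Lemma clocint_norm1c g : clocint g -> locint (fun t => norm1c (g t)).
Proof. by move=> [g1 g2]; apply: locintD; exact: locint_norm. Qed.

Lemma clocintM f g : ccontinuous f -> clocint g -> clocint (fun t => f t * g t).
Proof.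
move=> [f1 f2] [g1 g2]; split.
  by apply: locint_ext (locintB (locintM f1 g1) (locintM f2 g2)) _ => t; rewrite ReM.
by apply: locint_ext (locintD (locintM f1 g2) (locintM f2 g1)) _ => t; rewrite ImM.
Qed.

Lemma clocintB f g : clocint f -> clocint g -> clocint (fun t => f t - g t).
Proof.
move=> [f1 f2] [g1 g2]; split.
  by apply: locint_ext (locintB f1 g1) _ => t; rewrite !ReImE.
by apply: locint_ext (locintB f2 g2) _ => t; rewrite !ReImE.
Qed.

Lemma clocintN f : clocint f -> clocint (fun t => - f t).
Proof.
move=> [f1 f2]; split.
  by apply: locint_ext (locintN f1) _ => t; rewrite !ReImE.
by apply: locint_ext (locintN f2) _ => t; rewrite !ReImE.
Qed.

Lemma clocint_opp f : clocint f -> clocint (fun t => f (- t)).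
Proof. by move=> [f1 f2]; split; [exact: (locint_opp f1)|exact: (locint_opp f2)]. Qed.

Lemma cL1_approx f (T e : R) : clocint f -> 0 < T -> 0 < e ->
  exists L L' : R -> C, [/\ cacd L L',
    exists2 M : R, 0 <= M & forall x, 0 <= x <= T -> normc (L' x) <= M,
    clocint L &
    \int[mu]_(x in `[0, T]) norm1c (f x - L x) <= e].
Proof.
move=> [f1 f2] T0 e0; have e20 : 0 < e / 2 by rewrite divr_gt0.
have [L1 [L1' [a1 i1 [M1 M10 HM1] n1]]] := L1_approx f1 T0 e20.
have [L2 [L2' [a2 i2 [M2 M20 HM2] n2]]] := L1_approx f2 T0 e20.
have l1 := locint_continuous (acd_continuous a1).
have l2 := locint_continuous (acd_continuous a2).
exists (fun t => Complex (L1 t) (L2 t)), (fun t => Complex (L1' t) (L2' t)); split => //.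
  exists (M1 + M2) => [|x xT]; first exact: addr_ge0.
  by apply: le_trans (normc_le_norm1c _) _; apply: lerD; [exact: HM1|exact: HM2].
rewrite [e]splitr; apply: le_trans (lerD n1 n2).
rewrite -RintegralD//; last 2 first.
- exact: (locint_norm (locintB f1 l1)).
- exact: (locint_norm (locintB f2 l2)).
rewrite le_eqVlt; apply/orP; left; apply/eqP.
by apply: eq_Rintegral => t _; rewrite /norm1c !ReImE.
Qed.

End complex_absolute_continuity.

(** * The diagonalized system *)

Section dirac_system.
Context {R : realType}.
Local Notation C := R[i].
Local Notation Re := complex.Re.
Local Notation Im := complex.Im.
Local Notation normc := Normc.normc.
Local Notation mu := (@lebesgue_measure R).

(** Integrating factor [exp (K 0 - K x)]. It is at most 1 because [K] does not decrease, so the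
    constant forcing contributes no more than [c z]. *)
Lemma gronwall (S S' K kap : R -> R) (c z : R) : 0 <= z -> 0 <= c ->
  acd S S' -> acd K kap ->
  {ae mu, forall x, 0 <= x <= z -> 0 <= kap x /\ S' x <= kap x * S x + c} ->
  S z <= (S 0 + c * z) * expR (K z - K 0).
Proof.
move=> z0 c0 aS aK ineq.
have K0 x : 0 <= x <= z -> K 0 <= K x.
  move=> /andP[x0 xz]; have := acd_le x0 (acd_cst 0) aK.
  rewrite subrr subr_ge0; apply.
  apply: (@filterS _ _ (ae_filter_ringOfSetsType mu) _ _ _ ineq) => y + /andP[y0 yx].
  by rewrite y0 (le_trans yx xz) => /(_ isT)[].
have aG := acdM aS (acd_expR (acdB (acd_cst (K 0)) aK)).
have := acd_le z0 aG (acdZ c (@acd_id R)).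
rewrite subrr expR0 !mulr1 mulr0 subr0 => H.
have {}H : S z * expR (K 0 - K z) - S 0 <= c * z.
  apply: H; apply: (@filterS _ _ (ae_filter_ringOfSetsType mu) _ _ _ ineq) => x + xz.
  move=> /(_ xz)[kx Sx].
  have e1 : expR (K 0 - K x) <= 1 by rewrite -expR0 ler_expR subr_le0 K0.
  have e0 := expR_ge0 (K 0 - K x).
  move: e1 e0; set E := expR _ => e1 e0.
  have h1 : 0 <= E * (kap x * S x + c - S' x) by rewrite mulr_ge0// subr_ge0.
  have h2 : 0 <= c * (1 - E) by rewrite mulr_ge0// subr_ge0.
  by lra.
rewrite -ler_pdivrMr ?expR_gt0// -expRN opprB; lra.
Qed.

(** The real inner product of the plane: the derivative of [|y|^2] is [2 * dot y y']. *)
Definition dot (x y : C) : R := Re x * Re y + Im x * Im y.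

Lemma dotD (x y z : C) : dot x (y + z) = dot x y + dot x z.
Proof. by rewrite /dot !ReImE; ring. Qed.

Lemma dot_self (c x : C) : dot x (c * x) = Re c * normc x ^+ 2.
Proof. by rewrite sqr_normc /dot !ReImE; ring. Qed.

Lemma dot_le (x y : C) : dot x y <= normc x * normc y.
Proof.
have -> : dot x y = Re (conjc x * y) by rewrite ReM /dot; case: x => p q /=; ring.
apply: le_trans (Re_le_normc _) _; rewrite Normc.normcM.
by case: x => p q /=; rewrite sqrrN.
Qed.

Definition sqnorm (x y : C) : R := normc x ^+ 2 + normc y ^+ 2.

(* [om] stands for [- i lam], so that [Re om = Im lam]. *)
Definition dsystem (om : C) (al1 al2 : R -> R) (k1 k2 f1 f2 y1 y2 : R -> C) :=
  cacd y1 (fun t => (om + Complex 0 (al1 t)) * y1 t + k1 t * y2 t + f1 t) /\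
  cacd y2 (fun t => (- om + Complex 0 (al2 t)) * y2 t + k2 t * y1 t + f2 t).

(** Purely imaginary diagonal coefficients are orthogonal to the solution and drop out, which leaves
    [Re om] alone. The coupling is treated by [2 Y1 Y2 <= Y1^2 + Y2^2]; the forcing by
    [2 Y M <= Y^2 + M^2], the source of the summands [1] and [2 M^2]. *)
Lemma dsystem_energy (om : C) (a1 a2 : R) (k1 k2 f1 f2 y1 y2 : C) (M : R) :
  normc f1 <= M -> normc f2 <= M ->
  2 * (dot y1 ((om + Complex 0 a1) * y1 + k1 * y2 + f1) +
       dot y2 ((- om + Complex 0 a2) * y2 + k2 * y1 + f2)) <=
  (norm1c k1 + norm1c k2 + (2 * `|Re om| + 1)) * sqnorm y1 y2 + 2 * M ^+ 2.
Proof.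
move=> f1M f2M; rewrite !dotD !dot_self !ReImE /= !addr0 /sqnorm.
have := dot_le y1 (k1 * y2); rewrite Normc.normcM.
have := dot_le y2 (k2 * y1); rewrite Normc.normcM.
have := dot_le y1 f1; have := dot_le y2 f2.
have := normc_le_norm1c k1; have := normc_le_norm1c k2.
have := normc_ge0 y1; have := normc_ge0 y2.
have := normc_ge0 k1; have := normc_ge0 k2.
have := normc_ge0 f1; have := normc_ge0 f2.
have := ler_norm (Re om); have := ler_norm (- Re om); rewrite normrN.
move: f1M f2M.
move: (normc y1) (normc y2) (normc k1) (normc k2) (normc f1) (normc f2)
  (norm1c k1) (norm1c k2) (Re om) (dot y1 (k1 * y2)) (dot y2 (k2 * y1))
  (dot y1 f1) (dot y2 f2) => Y1 Y2 K1 K2 F1 F2 N1 N2 w D1 D2 E1 E2.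
move=> f1M f2M w1 w2 F20 F10 K20 K10 Y20 Y10 KN2 KN1 E2F E1F D2K D1K.
have s1 : 0 <= (`|w| - w) * Y1 ^+ 2 by rewrite mulr_ge0 ?sqr_ge0//; lra.
have s2 : 0 <= (`|w| + w) * Y2 ^+ 2 by rewrite mulr_ge0 ?sqr_ge0//; lra.
have s4 : Y1 * (K1 * Y2) <= N1 * (Y1 * Y2) by rewrite mulrCA ler_wpM2r// mulr_ge0.
have s5 : Y2 * (K2 * Y1) <= N2 * (Y1 * Y2).
  by rewrite mulrCA (mulrC Y2) ler_wpM2r// mulr_ge0.
have s6 : 2 * (N1 * (Y1 * Y2)) <= N1 * (Y1 ^+ 2 + Y2 ^+ 2).
  have : 0 <= N1 * (Y1 - Y2) ^+ 2 by rewrite mulr_ge0 ?sqr_ge0//; lra.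
  by rewrite !expr2; lra.
have s7 : 2 * (N2 * (Y1 * Y2)) <= N2 * (Y1 ^+ 2 + Y2 ^+ 2).
  have : 0 <= N2 * (Y1 - Y2) ^+ 2 by rewrite mulr_ge0 ?sqr_ge0//; lra.
  by rewrite !expr2; lra.
have s8 : 2 * (Y1 * F1) <= Y1 ^+ 2 + M ^+ 2.
  have : 0 <= (Y1 - M) ^+ 2 by rewrite sqr_ge0.
  have : Y1 * F1 <= Y1 * M by rewrite ler_wpM2l.
  by rewrite !expr2; lra.
have s9 : 2 * (Y2 * F2) <= Y2 ^+ 2 + M ^+ 2.
  have : 0 <= (Y2 - M) ^+ 2 by rewrite sqr_ge0.
  have : Y2 * F2 <= Y2 * M by rewrite ler_wpM2l.
  by rewrite !expr2; lra.
lra.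
Qed.

Lemma acd_sqnorm (y1 y2 d1 d2 : R -> C) : cacd y1 d1 -> cacd y2 d2 ->
  acd (fun t => sqnorm (y1 t) (y2 t))
      (fun t => 2 * (dot (y1 t) (d1 t) + dot (y2 t) (d2 t))).
Proof.
move=> [a1 b1] [a2 b2].
have := acdD (acdD (acdM a1 a1) (acdM b1 b1)) (acdD (acdM a2 a2) (acdM b2 b2)).
move=> /acd_ext; apply => t; first by rewrite /sqnorm !sqr_normc; ring.
by rewrite /dot; ring.
Qed.

Lemma dsystem_bound om al1 al2 (k1 k2 f1 f2 y1 y2 : R -> C) (Kp : R -> R) (M z : R) :
  acd Kp (fun t => norm1c (k1 t) + norm1c (k2 t)) ->
  dsystem om al1 al2 k1 k2 f1 f2 y1 y2 -> 0 <= z ->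
  (forall t, 0 <= t <= z -> normc (f1 t) <= M /\ normc (f2 t) <= M) ->
  sqnorm (y1 z) (y2 z) <= (sqnorm (y1 0) (y2 0) + 2 * M ^+ 2 * z) *
    expR (Kp z - Kp 0 + (2 * `|Re om| + 1) * z).
Proof.
move=> aK [s1 s2] z0 fM.
have aK' := acdD aK (acdZ (2 * `|Re om| + 1) (@acd_id R)).
have c0 : 0 <= 2 * M ^+ 2 by rewrite mulr_ge0 ?sqr_ge0.
have := gronwall z0 c0 (acd_sqnorm s1 s2) aK'.
rewrite mulr0 addr0 [_ + _ - _]addrAC; apply; apply: aeW => x xz.
split; first by rewrite mulr1 !addr_ge0 ?norm1c_ge0// mulr_ge0.
rewrite mulr1; have [f1M f2M] := fM x xz; exact: dsystem_energy.
Qed.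

(** The exponential on the right is the maximum of [|e^{-2 om t}|] over [[s, z]], written without a
    case distinction on the sign of [Re om]. The approximation error of [k] costs [e / 2] times it;
    every term of the integration by parts carries [1 / |om|], so the threshold depends neither on
    the direction of [om] nor on [s] and [z]. *)
Lemma riemann_lebesgue (k : R -> C) (T e : R) : clocint k -> 0 < T -> 0 < e ->
  exists2 r : R, 0 < r & forall om, r <= normc om ->
  forall P, cacd P (fun t => k t * cexp (- (2 * om) * t%:C%C)) ->
  forall s z : R, 0 <= s -> s <= z -> z <= T ->
  normc (P z - P s) <= e * expR (- Re om * (z + s) + `|Re om| * (z - s)).
Proof.
move=> Ik T0 e0; have e20 : 0 < e / 2 by rewrite divr_gt0.
have [L [L' [aL [M M0 HM] IL kL]]] := cL1_approx Ik T0 e20.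
have [N N0 HN] := ccontinuous_bounded 0 T (cacd_continuous aL).
(* Two boundary terms bounded by [N] and the integral of the derivative, bounded by [M]: together
   they give [B / (2 |om|)], at most [e / 2] once [|om| >= B / e]. *)
pose B := 2 * N + M * T.
have B0 : 0 <= B by rewrite addr_ge0// mulr_ge0// ltW.
exists (B / e + 1) => [|om omr P aP s z s0 sz zT].
  by rewrite ltr_wpDl// divr_ge0// ltW.
have om0 : 0 < normc om by apply: lt_le_trans omr; rewrite ltr_wpDl// divr_ge0// ltW.
have omn0 : 2 * om != 0.
  rewrite mulf_neq0 ?pnatr_eq0//; apply: contraTneq om0 => ->.
  by rewrite Normc.normc0 ltxx.
pose E := expR (- Re om * (z + s) + `|Re om| * (z - s)).
have E0 : 0 < E by exact: expR_gt0.
have EP (t : R) : s <= t -> t <= z -> normc (cexp (- (2 * om) * t%:C%C)) <= E.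
  move=> st tz; rewrite normc_cexp ler_expR !ReImE/=.
  rewrite [leLHS](_ : _ = - 2 * (Re om * t)); last by ring.
  have w1 := ler_norm (Re om); have w2 := ler_norm (- Re om); rewrite normrN in w2.
  have : 0 <= (`|Re om| - Re om) * (z - t) by rewrite mulr_ge0; lra.
  have : 0 <= (`|Re om| + Re om) * (t - s) by rewrite mulr_ge0; lra.
  by lra.
(* Integration by parts against the regular approximation [L] of [k]. *)
pose X t := P t + (2 * om)^-1 * (L t * cexp (- (2 * om) * t%:C%C)).
have aX : cacd X (fun t => (k t - L t + (2 * om)^-1 * L' t) * cexp (- (2 * om) * t%:C%C)).
  have aexp := cacd_exp (cacd_linear (- (2 * om))).
  apply: cacd_ext (cacdD aP (cacdZ (2 * om)^-1 (cacdM aL aexp))) _ _ => //.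
  move=> t; move: (cexp _) => ex; move: (2 * om) omn0 => w w0.
  by field.
have n2 : normc (2 * om) = 2 * normc om.
  by rewrite Normc.normcM (_ : 2 = 2%:C%C :> C) ?normcC ?gtr0_norm// rmorph_nat.
have Iw := clocint_norm1c (clocintB Ik IL).
have aw := acdZ E (acdD (acd_oint 0 Iw) (acdZ (M / (2 * normc om)) (@acd_id R))).
have HX : normc (X z - X s) <= E * (e / 2 + M / (2 * normc om) * T).
  apply: le_trans (cacd_le sz aX aw _) _.
    apply: aeW => t /andP[st tz].
    rewrite Normc.normcM mulrC ler_pM ?normc_ge0// ?EP//.
    apply: le_trans (le_normcD _ _) _; apply: lerD; first exact: normc_le_norm1c.
    rewrite mulr1 Normc.normcM Normc.normcV n2 mulrC ler_wpM2r//.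
      by rewrite invr_ge0 mulr_ge0// ltW.
    by apply: HM; rewrite (le_trans s0 st) (le_trans tz zT).
  rewrite -mulrBr ler_wpM2l ?(ltW E0)// opprD addrACA lerD//.
    rewrite ointB//; apply: le_trans kL.
    rewrite (Rintegral_itv_cat Iw s0 (le_trans sz zT)) (Rintegral_itv_cat Iw sz zT).
    have pos (a b : R) : 0 <= \int[mu]_(t in `[a, b]) norm1c (k t - L t).
      by apply: Rintegral_ge0 => t _; exact: norm1c_ge0.
    by rewrite addrCA lerDl; apply: addr_ge0; exact: pos.
  by rewrite -mulrBr ler_wpM2l ?divr_ge0 ?mulr_ge0 ?normc_ge0//; lra.
have bnd t : s <= t -> t <= z ->
    normc ((2 * om)^-1 * (L t * cexp (- (2 * om) * t%:C%C))) <= N / (2 * normc om) * E.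
  move=> st tz; rewrite !Normc.normcM Normc.normcV n2 mulrA [_^-1 * _]mulrC.
  rewrite ler_pM ?mulr_ge0 ?normc_ge0 ?invr_ge0 ?mulr_ge0 ?normc_ge0 ?EP//.
  rewrite ler_wpM2r ?invr_ge0 ?mulr_ge0 ?normc_ge0//.
  by apply: HN; [exact: le_trans st|exact: le_trans zT].
have -> : P z - P s = (X z - X s) - ((2 * om)^-1 * (L z * cexp (- (2 * om) * z%:C%C)) -
    (2 * om)^-1 * (L s * cexp (- (2 * om) * s%:C%C))).
  by rewrite /X; ring.
apply: le_trans (le_normcB _ _) _; apply: le_trans (lerD HX (le_normcB _ _)) _.
apply: le_trans (lerD (lexx _) (lerD (bnd _ sz (lexx _)) (bnd _ (lexx _) sz))) _.
have Bn : B / (2 * normc om) <= e / 2.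
  rewrite ler_pdivrMr ?mulr_gt0//.
  have : B / e <= normc om by apply: le_trans omr; rewrite lerDl.
  by rewrite ler_pdivrMr//; lra.
have -> : E * (e / 2 + M / (2 * normc om) * T) +
   (N / (2 * normc om) * E + N / (2 * normc om) * E) = E * (e / 2 + B / (2 * normc om)).
  by rewrite /B; ring.
by rewrite mulrC ler_wpM2r ?(ltW E0)//; lra.
Qed.

(** Exchanging the components only changes the sign of [om], so estimating the first component is
    enough. *)
Lemma dsystem_swap om al1 al2 (k1 k2 f1 f2 y1 y2 : R -> C) :
  dsystem om al1 al2 k1 k2 f1 f2 y1 y2 ->
  dsystem (- om) al2 al1 k2 k1 f2 f1 y2 y1.
Proof. by move=> [s1 s2]; split => //; rewrite opprK. Qed.

(** Time reversal keeps the shape of the system and carries negative [z] to positive ones. *)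
Lemma dsystem_reflect om al1 al2 (k1 k2 f1 f2 y1 y2 : R -> C) :
  dsystem om al1 al2 k1 k2 f1 f2 y1 y2 ->
  dsystem (- om) (fun t => - al1 (- t)) (fun t => - al2 (- t))
    (fun t => - k1 (- t)) (fun t => - k2 (- t))
    (fun t => - f1 (- t)) (fun t => - f2 (- t))
    (fun t => y1 (- t)) (fun t => y2 (- t)).
Proof.
move=> [/cacd_opp s1 /cacd_opp s2]; split.
  apply: cacd_ext s1 _ _ => // t; apply: complexP; rewrite !ReImE/= ; ring.
apply: cacd_ext s2 _ _ => // t; apply: complexP; rewrite !ReImE/= ; ring.
Qed.

Definition cI (a : R) : C := Complex 0 a.

Lemma dsystem_asymp_pos al1 al2 (k1 k2 : R -> C) (A1 A2 : R -> R) (T e : R) :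
  clocint k1 -> clocint k2 -> acd A1 al1 -> acd A2 al2 -> A1 0 = 0 -> A2 0 = 0 ->
  0 < T -> 0 < e ->
  exists2 r : R, 0 < r & forall om, r <= normc om -> forall y1 y2,
    dsystem om al1 al2 k1 k2 (fun=> 0) (fun=> 0) y1 y2 ->
    normc (y1 0) <= 1 -> normc (y2 0) <= 1 -> forall z, 0 <= z <= T ->
    normc (y1 z - cexp (om * z%:C%C + cI (A1 z)) * y1 0) <= e * expR (`|Re om| * z).
Proof.
move=> Ik1 Ik2 aA1 aA2 A10 A20 T0 e0.
have cA (A al : R -> R) : acd A al -> cacd (fun t => cI (A t)) (fun t => cI (al t)).
  by move=> aA; split => //=; exact: acd_cst.
have cA1 := cA _ _ aA1; have cA2 := cA _ _ aA2.
(* Only phases free of [om] are absorbed into [K1], so Riemann-Lebesgue is applied to a fixed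
   function. *)
pose K1 t := cexp (cI (A2 t) - cI (A1 t)) * k1 t.
have IK1 : clocint K1.
  by apply: clocintM Ik1; exact: cacd_continuous (cacd_exp (cacdB cA2 cA1)).
have Ikap := locintD (clocint_norm1c Ik1) (clocint_norm1c Ik2).
have aKp := acd_oint 0 Ikap; set Kp := oint _ 0 in aKp.
have Ik2n := clocint_norm1c Ik2.
have aN := acd_oint 0 Ik2n; set N := oint _ 0 in aN.
have mono (F f : R -> R) : acd F f -> (forall x, 0 <= f x) ->
    forall x y, x <= y -> F x <= F y.
  move=> aF f0 x y xy; rewrite -subr_ge0; have := acd_le xy (acd_cst 0) aF.
  by rewrite subrr; apply; exact: aeW.
have N0 : N 0 = 0 by exact: oint_refl.
have NT0 : 0 <= N T by rewrite -N0; apply: (mono _ _ aN) (ltW T0) => x; exact: norm1c_ge0.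
(* The factor 2 bounds the initial energy, both components starting with modulus at most 1; the
   square root of the energy bound is [c e^{|Re om| t}]. *)
pose D := 2 * expR (Kp T - Kp 0 + T).
pose c := Num.sqrt D.
have D0 : 0 <= D by rewrite mulr_ge0// expR_ge0.
have c0 : 0 <= c by exact: sqrtr_ge0.
have cNT : 0 <= c * N T by rewrite mulr_ge0.
(* The boundary term costs [d] and the integral of [P v'] costs [d c (N T)]; this choice makes them
   add up to [e]. *)
pose d := e / (1 + c * N T).
have d0 : 0 < d by rewrite divr_gt0// ltr_wpDr.
have [r r0 Hr] := riemann_lebesgue IK1 T0 d0.
exists r => // om omr y1 y2 sys y10 y20 z /andP[z0 zT].
have [s1 s2] := sys.
set h := `|Re om|; set w := Re om.
have ybound t : 0 <= t <= z -> normc (y1 t) <= c * expR (h * t).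
  move=> /andP[t0 tz].
  have := @dsystem_bound _ _ _ _ _ _ _ _ _ Kp 0 t aKp sys t0.
  rewrite Normc.normc0 expr0n/= mulr0 mul0r addr0 => /(_ (fun _ _ => conj (lexx _) (lexx _))) H.
  rewrite -(ler_pXn2r (n := 2))// ?nnegrE ?normc_ge0 ?mulr_ge0 ?expR_ge0//.
  rewrite exprMn sqr_sqrtr// -expRM_natl.
  apply: le_trans (le_trans H _); first by rewrite /sqnorm lerDl sqr_ge0.
  rewrite -mulrA -expRD ler_pM ?addr_ge0 ?sqr_ge0 ?expR_ge0//.
    have := normc_ge0 (y1 0); have := normc_ge0 (y2 0); rewrite /sqnorm !expr2; nra.
  rewrite ler_expR -/h.
  have : Kp t <= Kp T.
    by apply: (mono _ _ aKp) (le_trans tz zT) => x; rewrite addr_ge0 ?norm1c_ge0.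
  have : t <= T by exact: le_trans zT.
  by lra.
(* [u' = g v], so [(u - P v)' = - P v'] involves only the small factor [P]. *)
pose u t := cexp (- om * t%:C%C - cI (A1 t)) * y1 t.
pose v t := cexp (om * t%:C%C - cI (A2 t)) * y2 t.
pose g t := K1 t * cexp (- (2 * om) * t%:C%C).
have Ig : clocint g.
  have [ce1 ce2] := cacd_continuous (cacd_exp (cacd_linear (- (2 * om)))).
  rewrite /g; under [X in clocint X]eq_fun do rewrite mulrC.
  by apply: clocintM => //; split.
pose G := coint g 0.
have aG : cacd G g by exact: cacd_coint.
pose P t := G t - G z.
have aP : cacd P g.
  by apply: cacd_ext (cacdB aG (cacd_cst (G z))) _ _ => // t; rewrite subr0.
have Pb t : 0 <= t -> t <= z -> normc (P t) <= d * expR (- w * (z + t) + h * (z - t)).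
  by move=> t0 tz; rewrite -normcN opprB; apply: Hr.
have au := cacdM (cacd_exp (cacdB (cacd_linear (- om)) cA1)) s1.
have av := cacdM (cacd_exp (cacdB (cacd_linear om) cA2)) s2.
have aX := cacdB au (cacdM aP av).
pose Ea t := cexp (- om * t%:C%C - cI (A1 t)).
pose Eb t := cexp (om * t%:C%C - cI (A2 t)).
have gEb t : g t * Eb t = Ea t * k1 t.
  have -> : Ea t = cexp (cI (A2 t) - cI (A1 t)) * cexp (- (2 * om) * t%:C%C) * Eb t.
    by rewrite /Ea /Eb -!cexpD; congr cexp; ring.
  by rewrite /g /K1; ring.
have {}aX : cacd (fun t => u t - P t * v t) (fun t => - (P t * (Eb t * (k2 t * y1 t)))).
  apply: cacd_ext aX _ _ => // t; rewrite -!/(Ea t) -!/(Eb t) -!/(cI _).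
  by have := gEb t; move: (Ea t) (Eb t) => a b gb; rewrite mulrA gb; ring.
(* The weights [e^{-w (z + t) + h (z - t)}] of [P], [e^{w t}] of the phase and [e^{h t}] of [y1]
   multiply to [e^{h z - w z}]; the factor [e^{w z}] restored at the end turns this into
   [e^{h z}]. *)
pose Cst := d * c * expR (h * z - w * z).
have Cst0 : 0 <= Cst.
  by apply: mulr_ge0 (expR_ge0 _); apply: mulr_ge0 => //; exact: ltW.
have Nz : N z - N 0 <= N T.
  by rewrite N0 subr0; apply: (mono _ _ aN) zT => x; exact: norm1c_ge0.
have Xb : normc (u z - P z * v z - (u 0 - P 0 * v 0)) <= Cst * N T.
  apply: le_trans (ler_wpM2l Cst0 Nz); rewrite mulrBr.
  apply: (cacd_le z0 aX (acdZ Cst aN)); apply: aeW => t /andP[t0 tz].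
  rewrite normcN !Normc.normcM normc_cexp.
  have -> : Re (om * t%:C%C - cI (A2 t)) = w * t by rewrite !ReImE/= /w; ring.
  have Pt := Pb t t0 tz; have yt : normc (y1 t) <= c * expR (h * t).
    by apply: ybound; rewrite t0.
  have kt := normc_le_norm1c (k2 t).
  apply: (@le_trans _ _ (d * expR (- w * (z + t) + h * (z - t)) *
      (expR (w * t) * (norm1c (k2 t) * (c * expR (h * t)))))).
    rewrite ler_pM ?normc_ge0 ?mulr_ge0 ?normc_ge0 ?expR_ge0//.
    by rewrite ler_wpM2l ?expR_ge0// ler_pM ?normc_ge0.
  rewrite /Cst (_ : h * z - w * z =
    (- w * (z + t) + h * (z - t)) + w * t + h * t); last by ring.
  by rewrite !expRD le_eqVlt; apply/orP; left; apply/eqP; ring.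
have Pz : P z = 0 by rewrite /P subrr.
have cI0 : cI 0 = 0 by [].
have v00 : v 0 = y2 0.
  by rewrite /v A20 cI0 subr0 (_ : (0 : R)%:C%C = 0)// mulr0 cexp0 mul1r.
have u00 : u 0 = y1 0.
  by rewrite /u A10 cI0 subr0 (_ : (0 : R)%:C%C = 0)// mulr0 cexp0 mul1r.
rewrite Pz mul0r subr0 v00 in Xb.
have P0b : normc (P 0 * y2 0) <= d * expR (h * z - w * z).
  rewrite Normc.normcM -[leRHS]mulr1 ler_pM ?normc_ge0//.
  by have := Pb 0 (lexx _) z0; rewrite addr0 subr0 mulNr addrC.
have uz : normc (u z - u 0) <= Cst * N T + d * expR (h * z - w * z).
  rewrite (_ : u z - u 0 = (u z - (u 0 - P 0 * y2 0)) - P 0 * y2 0); last by ring.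
  exact: le_trans (le_normcB _ _) (lerD Xb P0b).
have -> : y1 z - cexp (om * z%:C%C + cI (A1 z)) * y1 0 =
    cexp (om * z%:C%C + cI (A1 z)) * (u z - u 0).
  rewrite u00 mulrBr /u mulrA -cexpD.
  have -> : om * z%:C%C + cI (A1 z) + (- om * z%:C%C - cI (A1 z)) = 0 by ring.
  by rewrite cexp0 mul1r.
rewrite Normc.normcM normc_cexp.
have -> : Re (om * z%:C%C + cI (A1 z)) = w * z by rewrite !ReImE/= /w; ring.
apply: le_trans (ler_wpM2l (expR_ge0 _) uz) _.
have -> : expR (h * z) = expR (w * z) * expR (h * z - w * z).
  by rewrite -expRD; congr expR; ring.
rewrite le_eqVlt; apply/orP; left; apply/eqP; rewrite /Cst /d; field.
by rewrite gt_eqF// ltr_wpDr.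
Qed.

(** Four instances of the one-sided estimate, one for each component and each sign of [z]; the sum
    of their thresholds serves all of them. *)
Lemma dsystem_asymp al1 al2 (k1 k2 : R -> C) (A1 A2 : R -> R) (T e : R) :
  clocint k1 -> clocint k2 -> acd A1 al1 -> acd A2 al2 -> A1 0 = 0 -> A2 0 = 0 ->
  0 < T -> 0 < e ->
  exists2 r : R, 0 < r & forall om, r <= normc om -> forall y1 y2,
    dsystem om al1 al2 k1 k2 (fun=> 0) (fun=> 0) y1 y2 ->
    normc (y1 0) <= 1 -> normc (y2 0) <= 1 -> forall z, `|z| <= T ->
    normc (y1 z - cexp (om * z%:C%C + cI (A1 z)) * y1 0) <= e * expR (`|Re om| * `|z|) /\
    normc (y2 z - cexp (- om * z%:C%C + cI (A2 z)) * y2 0) <= e * expR (`|Re om| * `|z|).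
Proof.
move=> I1 I2 aA1 aA2 A10 A20 T0 e0.
have [J1 J2] := (clocintN (clocint_opp I1), clocintN (clocint_opp I2)).
have [aB1 aB2] := (acd_opp aA1, acd_opp aA2).
have B10 : A1 (- 0) = 0 by rewrite oppr0.
have B20 : A2 (- 0) = 0 by rewrite oppr0.
have [r1 r10 H1] := dsystem_asymp_pos I1 I2 aA1 aA2 A10 A20 T0 e0.
have [r2 r20 H2] := dsystem_asymp_pos I2 I1 aA2 aA1 A20 A10 T0 e0.
have [r3 r30 H3] := dsystem_asymp_pos J1 J2 aB1 aB2 B10 B20 T0 e0.
have [r4 r40 H4] := dsystem_asymp_pos J2 J1 aB2 aB1 B20 B10 T0 e0.
exists (r1 + r2 + r3 + r4) => [|om omr y1 y2 sys y10 y20 z zT].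
  by rewrite !addr_gt0.
have ReN' : `|Re (- om)| = `|Re om| by rewrite ReN normrN.
have [z0|z0] := leP 0 z.
  have zT' : 0 <= z <= T by rewrite z0 -(ger0_norm z0).
  rewrite (ger0_norm z0); split; first by apply: H1 sys _ _ _ _ => //; lra.
  by rewrite -ReN'; apply: H2 (dsystem_swap sys) _ _ _ _ => //; rewrite normcN; lra.
have sys' := dsystem_reflect sys.
have sys'0 : dsystem (- om) (fun t => - al1 (- t)) (fun t => - al2 (- t))
    (fun t => - k1 (- t)) (fun t => - k2 (- t)) (fun=> 0) (fun=> 0)
    (fun t => y1 (- t)) (fun t => y2 (- t)).
  by move: sys'; rewrite oppr0.
have zT' : 0 <= - z <= T by rewrite -(ltr0_norm z0) normr_ge0.
have Nz : (- z)%:C%C = - z%:C%C :> C by apply: complexP; rewrite !ReImE/= ?oppr0.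
rewrite (ltr0_norm z0) -ReN'; split.
  have := H3 _ _ _ _ sys'0; rewrite !oppr0 normcN => /(_ _ y10 y20 _ zT').
  by rewrite opprK Nz mulrNN; apply; lra.
have := H4 _ _ _ _ (dsystem_swap sys'0); rewrite !oppr0 opprK => /(_ _ y20 y10 _ zT').
by rewrite opprK Nz mulrN -mulNr -ReN'; apply; lra.
Qed.

End dirac_system.

(** * The matrix exponential of [a I + b J] *)

Section exponential.
Context {R : realType}.
Local Notation C := R[i].
Local Notation Re := complex.Re.
Local Notation Im := complex.Im.
Local Notation normc := Normc.normc.
Local Notation mu := (@lebesgue_measure R).

Lemma normr_normc (x : C) : `|x| = (normc x)%:C%C.
Proof. by case: x. Qed.

(** The norm of [R[i]] takes its values in [R[i]]; this form of convergence keeps the radius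
    real. *)
Definition cvg_normc (T : Type) (F : set_system T) (f : T -> C) (l : C) :=
  forall e : R, 0 < e -> \forall x \near F, normc (l - f x) < e.

Lemma cvgC (T : Type) (F : set_system T) (f : T -> C) (l : C) : Filter F ->
  cvg_normc F f l -> f @ F --> l.
Proof.
move=> FF H; apply/cvgrPdist_lt => e e0.
have eR : e = (Re e)%:C%C.
  by move: e0; rewrite ltcE/= => /andP[/eqP e0 _]; apply: complexP.
have e1 : 0 < Re e by move: e0; rewrite eR ltcR.
by apply: filterS (H _ e1) => x; rewrite normr_normc eR ltcR.
Qed.

Lemma cvg_mx (T : Type) (F : set_system T) m n (f : T -> 'M[C]_(m.+1, n.+1))
    (l : 'M[C]_(m.+1, n.+1)) : Filter F ->
  (forall i j, (fun x => f x i j) @ F --> l i j) -> f @ F --> l.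
Proof.
move=> FF H; apply/cvg_ballP => e e0.
have : \forall x \near F, forall i j, ball (l i j) e (f x i j).
  by apply: filter_forall => i; apply: filter_forall => j; exact: (cvg_ball (H i j)).
by apply: filterS => x Hx; split.
Qed.

Definition exp_term (z : C) (k : nat) (t : R) : C := (k`!%:R)^-1 * (z * t%:C%C) ^+ k.

Lemma exp_termS z k t :
  exp_term z k.+1 t = (k.+1%:R)^-1 * (z * t%:C%C) * exp_term z k t.
Proof. by rewrite /exp_term factS natrM invfM exprS; ring. Qed.

Lemma exp_term0 z t : exp_term z 0 t = 1.
Proof. by rewrite /exp_term expr0 invr1 mulr1. Qed.

Lemma cacd_exp_term z k : cacd (exp_term z k.+1) (fun t => z * exp_term z k t).
Proof.
elim: k => [|k ih].
  apply: cacd_ext (cacd_linear z) _ _ => t.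
    by rewrite exp_termS exp_term0 mulr1 invr1 mul1r.
  by rewrite exp_term0 mulr1.
have := cacdM ih (cacdZ (k.+1%:R + 1)^-1 (cacd_linear z)).
have N0 : k.+1%:R != 0 :> C by rewrite pnatr_eq0.
have N1 : k.+1%:R + 1 != 0 :> C by rewrite natr1 pnatr_eq0.
move=> /cacd_ext; apply => t; rewrite ?(exp_termS _ k.+1) -?(natr1 k.+1).
  by ring.
rewrite !exp_termS; move: (exp_term z k t) => X; move: (k.+1%:R) N0 N1 => N N0 N1.
by field; rewrite N0 N1.
Qed.

Lemma cacd_sum_exp_term z n :
  cacd (fun t => \sum_(k < n.+1) exp_term z k t)
       (fun t => z * \sum_(k < n) exp_term z k t).
Proof.
elim: n => [|n ih].
  apply: cacd_ext (cacd_cst 1) _ _ => t; first by rewrite big_ord1 exp_term0.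
  by rewrite big_ord0 mulr0.
apply: cacd_ext (cacdD ih (cacd_exp_term z n)) _ _ => t.
  by rewrite [RHS]big_ord_recr.
by rewrite -mulrDr [in RHS]big_ord_recr.
Qed.

Lemma normc_nat n : normc (n%:R : C) = n%:R.
Proof.
have -> : (n%:R : C) = (n%:R : R)%:C%C by rewrite rmorph_nat.
by rewrite normcC ger0_norm.
Qed.

Lemma exp_term_le z k t : 0 <= t <= 1 ->
  normc (exp_term z k t) <= exp_coeff (normc z) k.
Proof.
move=> /andP[t0 t1]; rewrite /exp_coeff/= /exp_term Normc.normcM Normc.normcV.
rewrite normc_nat.
rewrite mulrC ler_wpM2r ?invr_ge0//.
have nX (x : C) : normc (x ^+ k) = normc x ^+ k.
  elim: k => [|k ih]; first by rewrite !expr0 Normc.normc1.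
  by rewrite !exprS Normc.normcM ih.
rewrite nX lerXn2r ?nnegrE ?normc_ge0// Normc.normcM normcC ger0_norm//.
by rewrite ler_piMr ?normc_ge0.
Qed.

(** Let [X t] be [e^{-z t}] times the partial sum of the series at [z t]. Differentiation telescopes
    and leaves only the last term, so [X 1 - X 0], which is the remainder up to the factor [- e^z],
    is bounded by a multiple of [|z|^n / n!]. *)
Lemma cvg_exp_series (z : C) :
  cvg_normc \oo (series (fun k => (k`!%:R)^-1 * z ^+ k)) (cexp z).
Proof.
have cz : exp_coeff (normc z) @ \oo --> (0 : R).
  exact: cvg_series_cvg_0 (is_cvg_series_exp_coeff (normc z)).
move=> e e0.
pose B := expR `|Re z| * expR (normc z) * normc z.
have B0 : 0 <= B by rewrite !mulr_ge0 ?expR_ge0 ?normc_ge0.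
have e'0 : 0 < e / (B + 1) by rewrite divr_gt0// ltr_wpDl.
move/cvgrPdist_lt : (cz) => /(_ _ e'0) H.
have [N _ HN] := H.
(* The partial sum of length [n + 1] ends with the term of degree [n], whence the shift. *)
exists N.+1 => // -[//|n] /= Nn.
have {HN} := HN n Nn; rewrite /= sub0r normrN ger0_norm ?exp_coeff_ge0 ?normc_ge0// => tn.
pose X t := cexp (- z * t%:C%C) * \sum_(k < n.+1) exp_term z k t.
have aX : cacd X (fun t => - (cexp (- z * t%:C%C) * (z * exp_term z n t))).
  apply: cacd_ext (cacdM (cacd_exp (cacd_linear (- z))) (cacd_sum_exp_term z n)) _ _ => // t.
  by rewrite big_ord_recr/=; ring.
have X0 : X 0 = 1.
  rewrite /X mulr0 cexp0 mul1r big_ord_recl exp_term0 big1 ?addr0// => i _.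
  by rewrite exp_termS mulr0 mulr0 mul0r.
have X1 : X 1 = cexp (- z) * series (fun k => (k`!%:R)^-1 * z ^+ k) n.+1.
  rewrite /X mulr1 /series /= big_mkord; congr (_ * _); apply: eq_bigr => i _.
  by rewrite /exp_term mulr1.
have XX : normc (X 1 - X 0) <= expR (normc z) * (normc z * exp_coeff (normc z) n).
  have := cacd_le ler01 aX (acdZ (expR (normc z) * (normc z * exp_coeff (normc z) n)) (@acd_id R)).
  rewrite mulr1 mulr0 subr0; apply; apply: aeW => t t01.
  rewrite normcN 2!Normc.normcM normc_cexp.
  rewrite ler_pM ?mulr_ge0 ?expR_ge0 ?normc_ge0//; last first.
    by rewrite ler_wpM2l ?normc_ge0// exp_term_le.
  rewrite ler_expR; apply: le_trans (Re_le_normc _) _.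
  rewrite Normc.normcM normcN normcC; move/andP: t01 => [t0 t1].
  by rewrite ger0_norm// ler_piMr ?normc_ge0.
have -> : cexp z - series (fun k => (k`!%:R)^-1 * z ^+ k) n.+1 = - (cexp z * (X 1 - X 0)).
  by rewrite X1 X0 mulrBr mulrA (mulrC (cexp z)) cexpN; ring.
rewrite normcN Normc.normcM normc_cexp.
apply: (@le_lt_trans _ _ (B * exp_coeff (normc z) n)).
  rewrite /B -!mulrA ler_pM ?expR_ge0 ?normc_ge0// ler_expR; exact: ler_norm.
move: tn; rewrite ltr_pdivlMr ?ltr_wpDl// => tn; apply: le_lt_trans tn.
by rewrite mulrC ler_wpM2l ?exp_coeff_ge0 ?normc_ge0// lerDl.
Qed.

Lemma ord2 (k : 'I_2) : k = 0 \/ k = 1.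
Proof. by case: k => [[|[|//]] lt]; [left|right]; apply: val_inj. Qed.

Lemma mx2_eqP (T : Type) (A B : 'M[T]_2) :
  A 0 0 = B 0 0 -> A 0 1 = B 0 1 -> A 1 0 = B 1 0 -> A 1 1 = B 1 1 -> A = B.
Proof.
by move=> ? ? ? ?; apply/matrixP => i j; case: (ord2 i) => ->; case: (ord2 j) => ->.
Qed.

Lemma mx2_entry (a b c d : C) : (mx2 a b c d 0 0 = a) * (mx2 a b c d 0 1 = b) *
  (mx2 a b c d 1 0 = c) * (mx2 a b c d 1 1 = d).
Proof. by rewrite /mx2 !mxE. Qed.

Lemma mulmx2E (A B : 'M[C]_2) i j : (A *m B) i j = A i 0 * B 0 j + A i 1 * B 1 j.
Proof.
rewrite mxE big_ord_recl big_ord1 /=.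
by rewrite (_ : lift ord0 ord0 = 1) //; apply: val_inj.
Qed.

(* The matrix [a I + b J] with [P = a + i b] and [M = a - i b], its eigenvalues
   on the left eigenvectors [(1, -i)] and [(1, i)]. *)
Definition spectral (P M : C) : 'M[C]_2 :=
  let a := (2^-1)%:C%C * (P + M) in let b := cI (- 2^-1) * (P - M) in
  mx2 a b (- b) a.

(** The matrices [a I + b J] have common eigenvectors, so algebra operations act separately on the
    two eigenvalues. *)
Lemma spectralM P M P' M' : spectral P M *m spectral P' M' = spectral (P * P') (M * M').
Proof.
have hv : (2^-1)%:C%C = 2^-1 :> C by apply: complexP; rewrite /= ; field.
have : cI (- 2^-1) * cI (- 2^-1) = - (2^-1 * 2^-1) :> C.
  by rewrite -hv; apply: complexP; rewrite !ReImE /=; field.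
rewrite /spectral hv; move: (cI _) => w ww.
have wwE x y : w * x * (w * y) = - (2^-1 * 2^-1) * (x * y) by rewrite -ww; ring.
by apply: mx2_eqP; rewrite mulmx2E !mx2_entry ?mulrN ?mulNr ?wwE; field.
Qed.

Lemma spectralD P M P' M' : spectral P M + spectral P' M' = spectral (P + P') (M + M').
Proof. by rewrite /spectral; apply: mx2_eqP; rewrite mxE !mx2_entry; ring. Qed.

Lemma spectralZ c P M : c *: spectral P M = spectral (c * P) (c * M).
Proof. by rewrite /spectral; apply: mx2_eqP; rewrite mxE !mx2_entry; ring. Qed.

Lemma spectral0 : spectral 0 0 = 0.
Proof. by rewrite -[X in spectral X X](mul0r 0) -spectralZ scale0r. Qed.

Lemma spectral1 : spectral 1 1 = 1%:M.
Proof.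
have hv : (2^-1)%:C%C = 2^-1 :> C by apply: complexP; rewrite /= ; field.
by apply: mx2_eqP; rewrite !mxE /= ?hv ?subrr ?mulr0 ?oppr0//; field.
Qed.

Lemma spectralX P M k : spectral P M ^+ k = spectral (P ^+ k) (M ^+ k).
Proof.
elim: k => [|k ih]; first by rewrite !expr0 spectral1.
by rewrite !exprS ih -spectralM.
Qed.

Lemma spectral_entries P M : let a := (2^-1)%:C%C * (P + M) in
  let b := cI (- 2^-1) * (P - M) in
  (spectral P M 0 0 = a) * (spectral P M 0 1 = b) *
  (spectral P M 1 0 = - b) * (spectral P M 1 1 = a).
Proof. by rewrite /= /spectral !mx2_entry. Qed.

Lemma cvg_normc_comb (T : Type) (F : set_system T) (a b : C) (p m : T -> C) (P M : C) :
  Filter F -> cvg_normc F p P -> cvg_normc F m M ->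
  cvg_normc F (fun x => a * p x + b * m x) (a * P + b * M).
Proof.
move=> FF cp cm e e0; pose n := normc a + normc b + 1.
have n0 : 0 < n by rewrite ltr_wpDl// addr_ge0 ?normc_ge0.
have en0 : 0 < e / n by rewrite divr_gt0.
apply: filterS2 (cp _ en0) (cm _ en0) => x px mx.
rewrite (_ : _ - _ = a * (P - p x) + b * (M - m x)); last by ring.
apply: le_lt_trans (le_normcD _ _) _; rewrite !Normc.normcM.
have := ler_wpM2l (normc_ge0 a) (ltW px); have := ler_wpM2l (normc_ge0 b) (ltW mx).
have : (normc a + normc b) * (e / n) < e.
  rewrite mulrA ltr_pdivrMr// mulrC ltr_pM2l//; rewrite /n; lra.
by rewrite mulrDl; lra.
Qed.

Lemma cvg_spectral (T : Type) (F : set_system T) (p m : T -> C) (P M : C) : Filter F ->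
  cvg_normc F p P -> cvg_normc F m M ->
  (fun x => spectral (p x) (m x)) @ F --> spectral P M.
Proof.
move=> FF cp cm; apply: cvg_mx => i j; apply: cvgC.
pose v : C := (2^-1)%:C%C; pose w : C := cI (- 2^-1).
have E p' m' : spectral p' m' i j =
    (if i == 0 then if j == 0 then v else w else if j == 0 then - w else v) * p' +
    (if i == 0 then if j == 0 then v else - w else if j == 0 then w else v) * m'.
  by rewrite /spectral /mx2 mxE -/v -/w; case: ifP => _; case: ifP => _; ring.
rewrite E; under [X in cvg_normc _ X]eq_fun do rewrite E.
exact: cvg_normc_comb.
Qed.

Lemma expmx_spectral P M : expmx (spectral P M) = spectral (cexp P) (cexp M).
Proof.
apply: cvg_lim; first exact: norm_hausdorff.
have -> : series (fun k : nat => k`!%:R^-1 *: spectral P M ^+ k) =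
    (fun n => spectral (series (fun k => (k`!%:R)^-1 * P ^+ k) n)
                       (series (fun k => (k`!%:R)^-1 * M ^+ k) n)).
  apply/funext => n; rewrite /series/=; elim: n => [|n ih].
    by rewrite !big_geq// spectral0.
  by rewrite !big_nat_recr//= ih spectralX spectralZ spectralD.
by apply: cvg_spectral; exact: cvg_exp_series.
Qed.

End exponential.

(** * Dependence on the spectral parameter *)

Section parameter.
Context {R : realType}.
Local Notation C := R[i].
Local Notation Re := complex.Re.
Local Notation Im := complex.Im.
Local Notation normc := Normc.normc.
Local Notation mu := (@lebesgue_measure R).

Lemma dsystem_comb om al1 al2 (k1 k2 f1 f2 y1 y2 g1 g2 x1 x2 : R -> C) (a b : C) :
  dsystem om al1 al2 k1 k2 f1 f2 y1 y2 -> dsystem om al1 al2 k1 k2 g1 g2 x1 x2 ->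
  dsystem om al1 al2 k1 k2 (fun t => a * f1 t + b * g1 t) (fun t => a * f2 t + b * g2 t)
    (fun t => a * y1 t + b * x1 t) (fun t => a * y2 t + b * x2 t).
Proof.
move=> [s1 s2] [t1 t2]; split.
  by apply: cacd_ext (cacdD (cacdZ a s1) (cacdZ b t1)) _ _ => // t; ring.
by apply: cacd_ext (cacdD (cacdZ a s2) (cacdZ b t2)) _ _ => // t; ring.
Qed.

(** A change of parameter is traded for a forcing term; solutions at different parameters can then
    be subtracted within one system. *)
Lemma dsystem_param om om' al1 al2 (k1 k2 y1 y2 : R -> C) :
  dsystem om' al1 al2 k1 k2 (fun=> 0) (fun=> 0) y1 y2 ->
  dsystem om al1 al2 k1 k2 (fun t => (om' - om) * y1 t) (fun t => (om - om') * y2 t) y1 y2.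
Proof.
move=> [s1 s2]; split.
  by apply: cacd_ext s1 _ _ => // t; ring.
by apply: cacd_ext s2 _ _ => // t; ring.
Qed.

Definition diff_quot (y : C -> C) (lam m : C) : C := (m - lam)^-1 * (y m - y lam).

(** Two rounds of the energy bound with zero initial values. The difference [y m - y n] is forced by
    multiples of [(m - n) y n], so it is of size [|m - n|]. The quotient at [m] solves the system at
    [lam] with forcing [c y1 m] and [- c y2 m], so two quotients differ by a solution forced by
    [y m - y n], again of size [|m - n|]. The unit factor [c] accommodates the sign change caused by
    reflection. *)
Lemma diff_quot_cauchy_pos (c lam : C) al1 al2 (k1 k2 : R -> C) (y1 y2 : C -> R -> C)
    (a1 a2 : C) (z : R) : normc c = 1 -> clocint k1 -> clocint k2 ->
  (forall m, dsystem (c * m) al1 al2 k1 k2 (fun=> 0) (fun=> 0) (y1 m) (y2 m)) ->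
  (forall m, y1 m 0 = a1) -> (forall m, y2 m 0 = a2) -> 0 <= z ->
  exists2 B : R, 0 <= B & forall m n, normc (m - lam) <= 1 -> normc (n - lam) <= 1 ->
    m != lam -> n != lam ->
    normc (diff_quot (y1 ^~ z) lam m - diff_quot (y1 ^~ z) lam n) <= B * normc (m - n) /\
    normc (diff_quot (y2 ^~ z) lam m - diff_quot (y2 ^~ z) lam n) <= B * normc (m - n).
Proof.
move=> c1 I1 I2 sys y10 y20 z0.
have aK := acd_oint 0 (locintD (clocint_norm1c I1) (clocint_norm1c I2)).
set Kp := oint _ 0 in aK.
have Kmono t : t <= z -> Kp t <= Kp z.
  move=> tz; rewrite -subr_ge0; have := acd_le tz (acd_cst 0) aK.
  by rewrite subrr; apply; apply: aeW => x _; rewrite addr_ge0 ?norm1c_ge0.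
(* On the unit disc around [lam] one has [|Re (c m)| <= |lam| + 1], which makes the energy bound
   uniform in [m]. *)
pose E := expR (Kp z - Kp 0 + (2 * (normc lam + 1) + 1) * z).
have E0 : 0 <= E by exact: expR_ge0.
have gen m f1 f2 x1 x2 M : normc (m - lam) <= 1 -> 0 <= M ->
    dsystem (c * m) al1 al2 k1 k2 f1 f2 x1 x2 ->
    (forall t, 0 <= t <= z -> normc (f1 t) <= M /\ normc (f2 t) <= M) ->
    forall t, 0 <= t <= z ->
    sqnorm (x1 t) (x2 t) <= (sqnorm (x1 0) (x2 0) + 2 * M ^+ 2 * z) * E.
  move=> ml M0 s fM t /andP[t0 tz].
  have fM' u : 0 <= u <= t -> normc (f1 u) <= M /\ normc (f2 u) <= M.
    by move=> /andP[u0 ut]; apply: fM; rewrite u0 (le_trans ut).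
  apply: le_trans (dsystem_bound aK s t0 fM') _.
  have M2 : 0 <= 2 * M ^+ 2 by rewrite mulr_ge0 ?sqr_ge0.
  rewrite ler_pM ?expR_ge0//.
  - by rewrite !addr_ge0 ?sqr_ge0 ?mulr_ge0.
  - by rewrite lerD2l ler_wpM2l.
  rewrite ler_expR; have := Kmono t tz.
  have : `|Re (c * m)| <= normc lam + 1.
    apply: le_trans (normRe_le_normc _) _; rewrite Normc.normcM c1 mul1r.
    have := le_normcD (m - lam) lam; rewrite subrK; lra.
  have := normr_ge0 (Re (c * m)); move: `|_| => h h0 hl.
  by have := normc_ge0 lam; nra.
have le_sq (x : C) (u : R) : 0 <= u -> normc x ^+ 2 <= u ^+ 2 -> normc x <= u.
  by move=> u0; rewrite ler_pXn2r ?nnegrE ?normc_ge0.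
pose D := Num.sqrt (2 * z * E).
have D0 : 0 <= D by exact: sqrtr_ge0.
have D2 : D ^+ 2 = 2 * z * E by rewrite sqr_sqrtr// !mulr_ge0.
have gen0 m f1 f2 x1 x2 M : normc (m - lam) <= 1 -> 0 <= M ->
    dsystem (c * m) al1 al2 k1 k2 f1 f2 x1 x2 -> x1 0 = 0 -> x2 0 = 0 ->
    (forall t, 0 <= t <= z -> normc (f1 t) <= M /\ normc (f2 t) <= M) ->
    forall t, 0 <= t <= z -> normc (x1 t) <= D * M /\ normc (x2 t) <= D * M.
  move=> ml M0 s x10 x20 fM t tz; have := gen _ _ _ _ _ _ ml M0 s fM t tz.
  rewrite x10 x20 /sqnorm !Normc.normc0 !expr0n/= !add0r.
  rewrite (_ : 2 * M ^+ 2 * z * E = (D * M) ^+ 2); last by rewrite exprMn D2; ring.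
  move=> H; split; apply: le_sq; rewrite ?mulr_ge0//; apply: le_trans H.
    by rewrite lerDl sqr_ge0.
  by rewrite lerDr sqr_ge0.
pose B0 := Num.sqrt (sqnorm a1 a2 * E).
have B00 : 0 <= B0 by exact: sqrtr_ge0.
have yB m t : normc (m - lam) <= 1 -> 0 <= t <= z ->
    normc (y1 m t) <= B0 /\ normc (y2 m t) <= B0.
  move=> ml tz; have := gen m _ _ _ _ 0 ml (lexx _) (sys m).
  rewrite Normc.normc0 => /(_ (fun _ _ => conj (lexx _) (lexx _)) t tz).
  rewrite y10 y20 expr0n/= mulr0 mul0r addr0.
  rewrite (_ : sqnorm a1 a2 * E = B0 ^+ 2); last first.
    by rewrite sqr_sqrtr// mulr_ge0// addr_ge0 ?sqr_ge0.
  move=> H; split; apply: le_sq => //; apply: le_trans H.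
    by rewrite lerDl sqr_ge0.
  by rewrite lerDr sqr_ge0.
have wB m n t : normc (m - lam) <= 1 -> normc (n - lam) <= 1 -> 0 <= t <= z ->
    normc (y1 m t - y1 n t) <= D * (normc (m - n) * B0) /\
    normc (y2 m t - y2 n t) <= D * (normc (m - n) * B0).
  move=> ml nl.
  have s1 := dsystem_param (c * m) (sys m).
  have s2 := dsystem_param (c * m) (sys n).
  have := dsystem_comb 1 (-1) s1 s2.
  move=> /(gen0 m _ _ _ _ (normc (m - n) * B0) ml).
  rewrite mulr_ge0 ?normc_ge0// !y10 !y20 !mul1r !mulN1r !subrr => /(_ isT erefl erefl) H tz.
  have := H _ t tz; rewrite !mul1r !mulN1r; apply => u uz.
  have [b1 b2] := yB n u nl uz.
  have nb x : normc x <= B0 -> normc (c * (m - n) * x) <= normc (m - n) * B0.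
    by move=> xB; rewrite !Normc.normcM c1 mul1r ler_wpM2l ?normc_ge0.
  split.
    by rewrite (_ : _ + _ = c * (m - n) * y1 n u); [exact: nb|ring].
  by rewrite (_ : _ + _ = - (c * (m - n) * y2 n u)); [rewrite normcN; exact: nb|ring].
exists (D * (D * B0)) => [|m n ml nl mlam nlam]; first by rewrite !mulr_ge0.
have s0 := dsystem_param (c * lam) (sys lam).
have sm := dsystem_param (c * lam) (sys m).
have sn := dsystem_param (c * lam) (sys n).
have := dsystem_comb 1 (-1) (dsystem_comb (m - lam)^-1 (- (m - lam)^-1) sm s0)
  (dsystem_comb (n - lam)^-1 (- (n - lam)^-1) sn s0).
have ll : normc (lam - lam) <= 1 by rewrite subrr Normc.normc0.
move=> /(gen0 lam _ _ _ _ (D * (normc (m - n) * B0)) ll).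
rewrite !mulr_ge0 ?normc_ge0// !y10 !y20 => /(_ isT) H.
have m0 : m - lam != 0 by rewrite subr_eq0.
have n0 : n - lam != 0 by rewrite subr_eq0.
have zz : 0 <= z <= z by rewrite z0 lexx.
have nc x : normc (c * x) = normc x by rewrite Normc.normcM c1 mul1r.
have [||t tz|h1 h2] := H _ _ _ z zz; [by ring|by ring| |].
  have [w1 w2] := wB m n t ml nl tz; split.
    rewrite (_ : _ + _ = c * (y1 m t - y1 n t)) ?nc//.
    by field; rewrite m0 n0.
  rewrite (_ : _ + _ = - (c * (y2 m t - y2 n t))) ?normcN ?nc//.
  by field; rewrite m0 n0.
rewrite -!mulrA [B0 * _]mulrC /diff_quot; split.
  by apply: le_trans h1; rewrite le_eqVlt; apply/orP; left; apply/eqP; congr normc; ring.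
by apply: le_trans h2; rewrite le_eqVlt; apply/orP; left; apply/eqP; congr normc; ring.
Qed.

Lemma diff_quot_cauchy (c lam : C) al1 al2 (k1 k2 : R -> C) (y1 y2 : C -> R -> C)
    (a1 a2 : C) (z : R) : normc c = 1 -> clocint k1 -> clocint k2 ->
  (forall m, dsystem (c * m) al1 al2 k1 k2 (fun=> 0) (fun=> 0) (y1 m) (y2 m)) ->
  (forall m, y1 m 0 = a1) -> (forall m, y2 m 0 = a2) ->
  exists2 B : R, 0 <= B & forall m n, normc (m - lam) <= 1 -> normc (n - lam) <= 1 ->
    m != lam -> n != lam ->
    normc (diff_quot (y1 ^~ z) lam m - diff_quot (y1 ^~ z) lam n) <= B * normc (m - n) /\
    normc (diff_quot (y2 ^~ z) lam m - diff_quot (y2 ^~ z) lam n) <= B * normc (m - n).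
Proof.
move=> c1 I1 I2 sys y10 y20; have [z0|z0] := leP 0 z.
  exact: diff_quot_cauchy_pos c1 I1 I2 sys y10 y20 z0.
have Nc1 : normc (- c) = 1 by rewrite normcN.
have sys' m : dsystem (- c * m) (fun t => - al1 (- t)) (fun t => - al2 (- t))
    (fun t => - k1 (- t)) (fun t => - k2 (- t)) (fun=> 0) (fun=> 0)
    (fun t => y1 m (- t)) (fun t => y2 m (- t)).
  by have := dsystem_reflect (sys m); rewrite oppr0 mulNr.
have z0' : 0 <= - z by rewrite oppr_ge0 ltW.
have := diff_quot_cauchy_pos lam Nc1 (clocintN (clocint_opp I1))
  (clocintN (clocint_opp I2)) sys' _ _ z0'.
move=> /(_ a1 a2 _ _)[m|m|B B0 H]; rewrite ?oppr0//.
by exists B => // m n; move: (H m n); rewrite /diff_quot opprK.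
Qed.

(** The limit is taken along the points [lam + 1/(n + 1)], where completeness of the reals suffices;
    the Lipschitz bound carries it over to every other approach to [lam]. *)
Lemma cauchy_limit (D : C -> C) (lam : C) (B : R) : 0 <= B ->
  (forall m n, normc (m - lam) <= 1 -> normc (n - lam) <= 1 ->
    m != lam -> n != lam -> normc (D m - D n) <= B * normc (m - n)) ->
  exists l, forall m, normc (m - lam) <= 1 -> m != lam ->
    normc (l - D m) <= B * normc (m - lam).
Proof.
move=> B0 DB.
pose h (n : nat) : C := (n.+1%:R^-1 : R)%:C%C.
have h0 n : h n != 0 by rewrite /h (_ : 0 = (0 : R)%:C%C)// (inj_eq (@complexI _)) invr_eq0 pnatr_eq0.
have hn n : normc (h n) = n.+1%:R^-1 by rewrite normcC ger0_norm.
have h1 n : normc (h n) <= 1 by rewrite hn invf_le1// ler1n.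
have lh n : lam + h n != lam by rewrite -subr_eq0 addrAC subrr add0r.
have lhE n : lam + h n - lam = h n by rewrite addrAC subrr add0r.
pose u n := D (lam + h n).
have uB m n : normc (u m - u n) <= B * (m.+1%:R^-1 + n.+1%:R^-1).
  apply: le_trans (DB _ _ _ _ _ _) _; rewrite ?lhE//.
  rewrite ler_wpM2l// opprD addrACA subrr add0r.
  by apply: le_trans (le_normcB _ _) _; rewrite !hn.
have cauchyu (p : C -> R) : (forall x y, p x - p y = p (x - y)) ->
    (forall x, `|p x| <= normc x) -> cvgn (p \o u).
  move=> pB pn; apply: cauchy_cvg; apply: cauchy_exP => e e0.
  pose N := Num.truncn (2 * B / e).
  have NB : 2 * B < N.+1%:R * e by rewrite -ltr_pdivrMr// truncnS_gt.
  exists (p (u N)); exists N => // n /= Nn; rewrite /ball/= pB.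
  apply: le_lt_trans (pn _) _; apply: le_lt_trans (uB _ _) _.
  have : n.+1%:R^-1 <= N.+1%:R^-1 :> R by rewrite lef_pV2 ?posrE// ler_nat ltnS.
  have : 2 * B * N.+1%:R^-1 < e by rewrite ltr_pdivrMr// (mulrC e).
  have : 0 <= N.+1%:R^-1 :> R by [].
  move: (N.+1%:R^-1) (n.+1%:R^-1) => p1 p2 p10 p1e p21.
  have : B * p2 <= B * p1 by rewrite ler_wpM2l.
  by lra.
have cR : cvgn (fun n => Re (u n)).
  by apply: (cauchyu (fun x => Re x)); [move=> x y; rewrite !ReImE|exact: normRe_le_normc].
have cI' : cvgn (fun n => Im (u n)).
  apply: (cauchyu (fun x => Im x)); first by move=> x y; rewrite !ReImE.
  by move=> x; have := normRe_le_normc (- 'i%C * x); rewrite !ReImE Normc.normcM normcN /=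
    !(oppr0, mul0r, mulN1r, opprK, add0r, expr0n, expr1n, sqrtr1, mul1r, subr0, sub0r).
pose l := Complex (limn (fun n => Re (u n))) (limn (fun n => Im (u n))).
exists l => m ml mlam.
apply/ler_addgt0Pr => e e0; have e40 : 0 < e / 4 by rewrite divr_gt0.
move/cvgrPdist_lt : cR => /(_ _ e40) nR.
move/cvgrPdist_lt : cI' => /(_ _ e40) nI.
have nh : \forall n \near \oo, B * n.+1%:R^-1 < e / 4.
  exists (Num.truncn (4 * B / e)) => // n /= Nn.
  have : 4 * B / e < n.+1%:R.
    by apply: lt_le_trans (truncnS_gt _) _; rewrite ler_nat ltnS.
  by rewrite ltr_pdivrMr// => H; rewrite ltr_pdivrMr//; lra.
have [n [[nR' nI'] nh']] := filter_ex (filterI (filterI nR nI) nh).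
have ln : normc (l - u n) <= e / 2.
  apply: le_trans (normc_le_norm1c _) _; rewrite /norm1c !ReImE/=; lra.
rewrite (_ : l - D m = (l - u n) - (D m - u n)); last by ring.
apply: le_trans (le_normcB _ _) _.
have := DB m (lam + h n) ml; rewrite lhE => /(_ (h1 n) mlam (lh n)) mu'.
have : normc (m - (lam + h n)) <= normc (m - lam) + n.+1%:R^-1.
  by rewrite opprD addrA -(hn n); exact: le_normcB.
move=> /(ler_wpM2l B0); rewrite mulrDr => h3.
apply: le_trans (lerD ln (le_trans mu' h3)) _.
rewrite addrCA lerD2l; apply: le_trans (lerD (lexx _) (ltW nh')) _; lra.
Qed.

Lemma derivable_mx2 (F : C -> 'M[C]_2) (lam : C) :
  (forall i j, exists l, exists2 B : R, 0 <= B & forall m, normc (m - lam) <= 1 ->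
     m != lam -> normc (l - diff_quot (fun x => F x i j) lam m) <= B * normc (m - lam)) ->
  derivable F lam 1.
Proof.
move=> H; apply/cvg_ex; exists (\matrix_(i, j) projT1 (cid (H i j))).
apply: cvg_mx => i j; rewrite mxE; case: cid => l /= [B B0 HB].
apply: cvgC => e e0.
have d0 : 0 < Num.min 1 (e / (B + 1)) by rewrite lt_min ltr01 divr_gt0// ltr_wpDl.
exists (Num.min 1 (e / (B + 1)))%:C%C; first by rewrite /= ltcR.
move=> h /=; rewrite sub0r normrN normr_normc ltcR lt_min => /andP[h1 he] hn0.
rewrite !mxE /GRing.scale/= mulr1.
have := HB (h + lam); rewrite /diff_quot addrK; rewrite -subr_eq0 addrK => /(_ (ltW h1) hn0) H1.
apply: le_lt_trans H1 _; apply: (@le_lt_trans _ _ ((B + 1) * normc h)).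
  by rewrite ler_wpM2r ?normc_ge0// lerDl.
by rewrite mulrC -ltr_pdivlMr// ltr_wpDl.
Qed.

End parameter.

(** * Order of growth *)

Section growth.
Context {R : realType}.
Local Notation C := R[i].
Local Notation Re := complex.Re.
Local Notation Im := complex.Im.
Local Notation normc := Normc.normc.

Lemma limf_esup_pinfty (g : R -> R) (l : R) :
  (forall e, 0 < e -> exists r0, forall r, r0 <= r -> `|g r - l| <= e) ->
  limf_esup (fun r => (g r)%:E) +oo = l%:E.
Proof.
move=> gl; apply/eqP; rewrite eq_le; apply/andP; split.
  apply/lee_addgt0Pr => e e0; have [r0 Hr] := gl e e0.
  apply: (@le_trans _ _ (ereal_sup [set (g r)%:E | r in [set r | r0 < r]])).
    apply: ereal_inf_lbound; exists [set r | r0 < r] => //.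
    by exists r0; split => //; exact: num_real.
  apply: ge_ereal_sup => _ [r /= rr <-]; rewrite -EFinD lee_fin.
  by have /ler_normlP[] := Hr r (ltW rr); lra.
apply: le_ereal_inf_tmp => _ [V [M [_ HM]] <-].
apply/lee_subgt0Pr => e e0; have [r0 Hr] := gl e e0.
pose r := Num.max (M + 1) r0.
have Mr : M < r by rewrite lt_max ltrDl ltr01.
have r0r : r0 <= r by rewrite le_max lexx orbT.
apply: (@le_trans _ _ (g r)%:E).
  by rewrite -EFinB lee_fin; have /ler_normlP[] := Hr r r0r; lra.
by apply: ereal_sup_ubound; exists r => //; exact: HM.
Qed.

(** For large [r] the logarithm of the maximum modulus lies between [a r / 2] and [2 a r], so its
    own logarithm is [ln r] up to a bounded error. A lower bound at a single point of each circle
    suffices. *)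
Lemma growth_order_eq1 (F : C -> 'M[C]_2) (a c1 c2 r0 : R) : 0 < a -> 0 < c1 -> 0 < c2 ->
  (forall lam, r0 <= normc lam -> opnorm (F lam) <= c2 * expR (a * normc lam)) ->
  (forall r, r0 <= r -> exists2 lam, normc lam = r & c1 * expR (a * r) <= opnorm (F lam)) ->
  growth_order F = 1%E.
Proof.
move=> a0 c10 c20 up lo; apply: limf_esup_pinfty => e e0.
pose K := `|ln (a / 2)| + `|ln (2 * a)|.
pose N := `|ln c1| + `|ln c2|.
(* Beyond [2 N / a] the constants [c1] and [c2] are absorbed into a factor 2 of [a r]; beyond
   [expR (K / e + 1)] the bounded error [K] is at most [e * ln r], and [ln r] is positive. *)
exists (`|r0| + 2 * N / a + expR (K / e + 1)) => r rr.
have K0 : 0 <= K by exact: addr_ge0.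
have N0 : 0 <= N by exact: addr_ge0.
have Na0 : 0 <= 2 * N / a by rewrite divr_ge0 ?mulr_ge0// ltW.
have E0 := expR_gt0 (K / e + 1).
have r0' := ler_norm r0; have r0'' := normr_ge0 r0.
have rr0 : r0 <= r by lra.
have rN : 2 * N / a <= r by lra.
have rE : expR (K / e + 1) <= r by lra.
have r1 : 0 < r by lra.
have lnr : K / e + 1 <= ln r by rewrite -(expRK (K / e + 1)) ler_ln ?posrE.
have Ke0 : 0 <= K / e by rewrite divr_ge0// ltW.
have lnr0 : 0 < ln r by lra.
have {}rN : 2 * N <= a * r by rewrite (mulrC a) -ler_pdivrMr.
have mM : c1 * expR (a * r) <= max_modulus F r <= c2 * expR (a * r).
  have [lam lamr Hlam] := lo r rr0.
  have ub : ubound [set opnorm (F lam) | lam in [set lam | normc lam = r]] (c2 * expR (a * r)).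
    by move=> _ [m /= mr <-]; rewrite -mr up// mr.
  apply/andP; split.
    by apply: le_trans Hlam _; apply: ub_le_sup; [eexists; exact: ub|exists lam].
  by apply: ge_sup => //; exists (opnorm (F lam)); exists lam.
have /andP[m1 m2] := mM.
have M0 : 0 < max_modulus F r by apply: lt_le_trans m1; rewrite mulr_gt0// expR_gt0.
have lnE c : 0 < c -> ln (c * expR (a * r)) = ln c + a * r.
  by move=> c0; rewrite lnM ?posrE ?expR_gt0// expRK.
have l1 : a / 2 * r <= ln (max_modulus F r).
  move: m1; rewrite -ler_ln ?posrE ?mulr_gt0 ?expR_gt0// lnE//; apply: le_trans.
  have := ler_norm (- ln c1); rewrite normrN; have := normr_ge0 (ln c2).
  by move: rN; rewrite /N; lra.
have l2 : ln (max_modulus F r) <= 2 * a * r.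
  move: m2; rewrite -ler_ln ?posrE ?mulr_gt0 ?expR_gt0// lnE// => /le_trans; apply.
  have := ler_norm (ln c2); have := normr_ge0 (ln c1).
  by have : 0 <= a * r by [rewrite mulr_ge0 ?ltW]; move: rN; rewrite /N; lra.
have a20 : 0 < a / 2 by rewrite divr_gt0.
have a2 : 0 < 2 * a by rewrite mulr_gt0.
have lM0 : 0 < ln (max_modulus F r) by apply: lt_le_trans l1; rewrite mulr_gt0.
have ll1 : ln (a / 2) + ln r <= ln (ln (max_modulus F r)).
  by rewrite -lnM ?posrE// ler_ln ?posrE// mulr_gt0.
have ll2 : ln (ln (max_modulus F r)) <= ln (2 * a) + ln r.
  by rewrite -lnM ?posrE// ler_ln ?posrE// mulr_gt0.
have -> : ln (ln (max_modulus F r)) / ln r - 1 = (ln (ln (max_modulus F r)) - ln r) / ln r.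
  by field; rewrite gt_eqF.
rewrite normrM normfV (gtr0_norm lnr0) ler_pdivrMr//.
apply: (@le_trans _ _ K).
  have := ler_norm (- ln (a / 2)); rewrite normrN; have := normr_ge0 (ln (a / 2)).
  have := ler_norm (ln (2 * a)); have := normr_ge0 (ln (2 * a)).
  by rewrite ler_norml /K; lra.
have : K / e <= ln r by lra.
by rewrite ler_pdivrMr// [e * _]mulrC.
Qed.

Lemma opnormE (A : 'M[C]_2) : opnorm A =
  Num.max (normc (A 0 0) + normc (A 1 0)) (normc (A 0 1) + normc (A 1 1)).
Proof.
have l01 : lift ord0 ord0 = 1 :> 'I_2 by apply: val_inj.
rewrite /opnorm !big_ord_recl !big_ord0 !l01 /=.
rewrite !addr0; congr Num.max.
by rewrite max_l// addr_ge0 ?normc_ge0.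
Qed.

End growth.

(** * The Dirac equation *)

Section solution.
Context {R : realType}.
Local Notation C := R[i].
Local Notation Re := complex.Re.
Local Notation Im := complex.Im.
Local Notation normc := Normc.normc.
Local Notation mu := (@lebesgue_measure R).

Lemma acd_ae (f g g' : R -> R) : acd f g -> {ae mu, forall x, g x = g' x} -> acd f g'.
Proof.
move=> [cf df] gg; split => //.
apply: (@filterS2 _ _ (ae_filter_ringOfSetsType mu) _ _ _ _ df gg) => x.
by move=> + <-.
Qed.

Variables (q1 q2 : R -> R) (q : R -> C).

(* [Y' = J (Q - lam) Y], column by column. *)
Definition is_fundamental (lam : C) (Y : R -> 'M[C]_2) := forall j,
  cacd (fun t => Y t 0 j) (fun t => conjc (q t) * Y t 0 j + ((q2 t)%:C%C - lam) * Y t 1 j) /\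
  cacd (fun t => Y t 1 j) (fun t => (lam - (q1 t)%:C%C) * Y t 0 j - q t * Y t 1 j).

Lemma is_solution_fundamental lam Y :
  is_solution (Qmx q1 q2 q) lam Y -> is_fundamental lam Y.
Proof.
move=> [cY dY] j.
have D i : cacd (fun t => Y t i j) (fun t => mx_derive Y t i j).
  split; split.
  - by move=> a b ab; have [] := cY a b ab i j.
  - apply: (@filterS _ _ (ae_filter_ringOfSetsType mu) _ _ _ dY) => x [+ _].
    by move=> /(_ i j)[+ _]; rewrite mxE /= derive1E => /derivableP.
  - by move=> a b ab; have [] := cY a b ab i j.
  - apply: (@filterS _ _ (ae_filter_ringOfSetsType mu) _ _ _ dY) => x [+ _].
    by move=> /(_ i j)[_ +]; rewrite mxE /= derive1E => /derivableP.
have E : {ae mu, forall t,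
    mx_derive Y t 0 j = conjc (q t) * Y t 0 j + ((q2 t)%:C%C - lam) * Y t 1 j /\
    mx_derive Y t 1 j = (lam - (q1 t)%:C%C) * Y t 0 j - q t * Y t 1 j}.
  apply: (@filterS _ _ (ae_filter_ringOfSetsType mu) _ _ _ dY) => t [_] eqY.
  have e0 := congr1 (fun A : 'M[C]_2 => A 0 j) eqY.
  have e1 := congr1 (fun A : 'M[C]_2 => A 1 j) eqY.
  rewrite [LHS]mxE [RHS]mxE !mulmx2E /Jmx /Qmx !mx2_entry in e0.
  rewrite [LHS]mxE [RHS]mxE !mulmx2E /Jmx /Qmx !mx2_entry in e1.
  move: e0 e1; move: (mx_derive Y t 0 j) (mx_derive Y t 1 j) => d0 d1 e0 e1.
  split.
    rewrite -[LHS]addr0 -(subrr (lam * Y t 1 j)) -{1}e1; ring.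
  rewrite -[LHS]addr0 -(subrr (lam * Y t 0 j)) -{2}e0; ring.
have [D0 D1] := (D 0, D 1).
split; split.
- apply: acd_ae D0.1 _.
  by apply: (@filterS _ _ (ae_filter_ringOfSetsType mu) _ _ _ E) => t [-> _].
- apply: acd_ae D0.2 _.
  by apply: (@filterS _ _ (ae_filter_ringOfSetsType mu) _ _ _ E) => t [-> _].
- apply: acd_ae D1.1 _.
  by apply: (@filterS _ _ (ae_filter_ringOfSetsType mu) _ _ _ E) => t [_ ->].
- apply: acd_ae D1.2 _.
  by apply: (@filterS _ _ (ae_filter_ringOfSetsType mu) _ _ _ E) => t [_ ->].
Qed.

Let al1 t := 2^-1 * (q1 t + q2 t) - Im (q t).
Let al2 t := - (2^-1 * (q1 t + q2 t)) - Im (q t).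
Let k1 t := Complex (Re (q t)) (2^-1 * (q1 t - q2 t)).
Let k2 t := Complex (Re (q t)) (- (2^-1 * (q1 t - q2 t))).
(* Coordinates along the left eigenvectors [(1, -i)] and [(1, i)] of [J]. *)
Definition lcoord (Y : 'M[C]_2) j := Y 0 j - 'i%C * Y 1 j.
Definition rcoord (Y : 'M[C]_2) j := Y 0 j + 'i%C * Y 1 j.

Lemma fundamental_dsystem lam Y j : is_fundamental lam Y ->
  dsystem (- 'i%C * lam) al1 al2 k1 k2 (fun=> 0) (fun=> 0)
    (fun t => lcoord (Y t) j) (fun t => rcoord (Y t) j).
Proof.
move=> /(_ j)[D0 D1]; split.
  apply: cacd_ext (cacdB D0 (cacdZ 'i%C D1)) _ _ => // t.
  rewrite /lcoord /rcoord /al1 /k1; apply: complexP; rewrite !ReImE /=.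
    by case: (q t) => a b /=; field.
  by case: (q t) => a b /=; field.
apply: cacd_ext (cacdD D0 (cacdZ 'i%C D1)) _ _ => // t.
rewrite /lcoord /rcoord /al2 /k2; apply: complexP; rewrite !ReImE /=.
  by case: (q t) => a b /=; field.
by case: (q t) => a b /=; field.
Qed.

End solution.

(** * Passage between matrix entries and eigenvector coordinates *)

Section coordinates.
Context {R : realType}.
Local Notation C := R[i].
Local Notation Re := complex.Re.
Local Notation Im := complex.Im.
Local Notation normc := Normc.normc.

Lemma lcoordB (A B : 'M[C]_2) j : lcoord (A - B) j = lcoord A j - lcoord B j.
Proof. by rewrite /lcoord !mxE; ring. Qed.

Lemma rcoordB (A B : 'M[C]_2) j : rcoord (A - B) j = rcoord A j - rcoord B j.
Proof. by rewrite /rcoord !mxE; ring. Qed.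

Lemma normci : normc 'i%C = 1 :> R.
Proof. by rewrite /= expr0n expr1n add0r sqrtr1. Qed.

Lemma lcoord_id j : lcoord (1%:M : 'M[C]_2) j = if j == 0 then 1 else - 'i%C.
Proof.
by case: (ord2 j) => ->; rewrite /lcoord !mxE /= ?mulr0 ?mulr1 ?subr0 ?sub0r.
Qed.

Lemma rcoord_id j : rcoord (1%:M : 'M[C]_2) j = if j == 0 then 1 else 'i%C.
Proof.
by case: (ord2 j) => ->; rewrite /rcoord !mxE /= ?mulr0 ?mulr1 ?addr0 ?add0r.
Qed.

Lemma normc_lcoord1 j : normc (lcoord (1%:M : 'M[C]_2) j) <= 1.
Proof. by rewrite lcoord_id; case: ifP => _; rewrite ?normcN ?normci ?Normc.normc1. Qed.

Lemma normc_rcoord1 j : normc (rcoord (1%:M : 'M[C]_2) j) <= 1.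
Proof. by rewrite rcoord_id; case: ifP => _; rewrite ?normci ?Normc.normc1. Qed.

Lemma spectral_half : (2^-1)%:C%C = 2^-1 :> C /\ cI (- 2^-1) = - 'i%C * 2^-1 :> C.
Proof.
have hv : (2^-1)%:C%C = 2^-1 :> C by apply: complexP; rewrite /=; field.
by split=> //; rewrite -hv; apply: complexP; rewrite !ReImE /=; ring.
Qed.

Lemma lcoord_spectral (P M : C) j : lcoord (spectral P M) j = P * lcoord 1%:M j.
Proof.
have [hv hw] := spectral_half; have ii : 'i%C * 'i%C = -1 :> C by rewrite -expr2 sqr_i.
rewrite lcoord_id; case: (ord2 j) => ->; rewrite /lcoord !spectral_entries hv hw /=.
  rewrite (_ : _ - _ = 2^-1 * (P + M) - 'i%C * 'i%C * 2^-1 * (P - M)); last by ring.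
  by rewrite ii; field.
by field.
Qed.

Lemma rcoord_spectral (P M : C) j : rcoord (spectral P M) j = M * rcoord 1%:M j.
Proof.
have [hv hw] := spectral_half; have ii : 'i%C * 'i%C = -1 :> C by rewrite -expr2 sqr_i.
rewrite rcoord_id; case: (ord2 j) => ->; rewrite /rcoord !spectral_entries hv hw /=.
  rewrite (_ : _ + _ = 2^-1 * (P + M) + 'i%C * 'i%C * 2^-1 * (P - M)); last by ring.
  by rewrite ii; field.
by field.
Qed.

(** Together with [coef2], the inverse of the change of coordinates. *)
Definition coef1 (i : 'I_2) : C := if i == 0 then (2^-1)%:C%C else cI 2^-1.
Definition coef2 (i : 'I_2) : C := if i == 0 then (2^-1)%:C%C else cI (- 2^-1).

Lemma normc_coef i : normc (coef1 i) = 2^-1 /\ normc (coef2 i) = 2^-1.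
Proof.
rewrite /coef1 /coef2; case: ifP => _.
  by rewrite normcC ger0_norm.
by rewrite /= expr0n /= !add0r sqrrN sqrtr_sqr ger0_norm.
Qed.

Lemma coord_entry (A : 'M[C]_2) i j :
  A i j = coef1 i * lcoord A j + coef2 i * rcoord A j.
Proof.
case: (ord2 i) => ->; rewrite /coef1 /coef2 /lcoord /rcoord /=;
  by apply: complexP; rewrite !ReImE /=; field.
Qed.

Lemma opnorm_coord_le (A : 'M[C]_2) (b : R) :
  (forall j, normc (lcoord A j) <= b /\ normc (rcoord A j) <= b) -> opnorm A <= 2 * b.
Proof.
move=> H; have E i j : normc (A i j) <= b.
  rewrite coord_entry; apply: le_trans (le_normcD _ _) _.
  have [c1 c2] := normc_coef i; have [h1 h2] := H j.
  by rewrite !Normc.normcM c1 c2; lra.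
have := (E 0 0, E 0 1, E 1 0, E 1 1) => -[[[e1 e2] e3] e4].
by rewrite opnormE ge_max; apply/andP; split; lra.
Qed.

Lemma lcoord_le_opnorm (A : 'M[C]_2) : normc (lcoord A 0) <= opnorm A.
Proof.
rewrite opnormE le_max; apply/orP; left; apply: le_trans (le_normcB _ _) _.
by rewrite Normc.normcM normci mul1r.
Qed.

End coordinates.

(** * The solution normalized at the origin *)

Section fundamental.
Context {R : realType}.
Local Notation C := R[i].
Local Notation Re := complex.Re.
Local Notation Im := complex.Im.
Local Notation normc := Normc.normc.
Local Notation mu := (@lebesgue_measure R).
Variables (q1 q2 : R -> R) (q : R -> C).
Hypotheses (Iq1 : locint q1) (Iq2 : locint q2) (Iq : clocint q).

Let al (t : R) : R := 2^-1 * (q1 t + q2 t).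
Let be (t : R) : R := Im (q t).
Let k1 t := Complex (Re (q t)) (2^-1 * (q1 t - q2 t)).
Let k2 t := Complex (Re (q t)) (- (2^-1 * (q1 t - q2 t))).

Let Ial : locint al.
Proof. exact: locintZ (locintD Iq1 Iq2). Qed.
Let Ibe : locint be.
Proof. exact: Iq.2. Qed.
Let Ik1 : clocint k1.
Proof. by split; [exact: Iq.1|exact: locintZ (locintB Iq1 Iq2)]. Qed.
Let Ik2 : clocint k2.
Proof. by split; [exact: Iq.1|exact: locintN (locintZ _ (locintB Iq1 Iq2))]. Qed.

Let A1 z := oint al 0 z - oint be 0 z.
Let A2 z := - oint al 0 z - oint be 0 z.

Lemma Q2mx_entries t : Q2mx q1 q2 q t =
  mx2 (al t)%:C%C (Complex 0 (be t)) (Complex 0 (- be t)) (al t)%:C%C.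
Proof.
apply: mx2_eqP; rewrite !mxE /= ?mulr0 ?mulr1 ?addr0 ?add0r//;
  by apply: complexP; rewrite !ReImE /=; ring.
Qed.

Lemma oint0 (a b : R) : oint (fun=> 0) a b = 0.
Proof. by rewrite /oint /Rintegral !integral0; case: ifP => _; rewrite ?oppr0. Qed.

Lemma ointN (f : R -> R) (a b : R) : locint f -> oint (fun t => - f t) a b = - oint f a b.
Proof.
move=> If; have N x y : \int[mu]_(t in `[x, y]) (- f t) = - \int[mu]_(t in `[x, y]) f t.
  rewrite -mulN1r -RintegralZl//.
  by apply: eq_Rintegral => t _; rewrite mulN1r.
by rewrite /oint !N; case: ifP.
Qed.

Lemma mx_oint_Q2mx z : mx_oint (Q2mx q1 q2 q) 0 z =
  mx2 (oint al 0 z)%:C%C (Complex 0 (oint be 0 z)) (Complex 0 (- oint be 0 z))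
    (oint al 0 z)%:C%C.
Proof.
rewrite (funext Q2mx_entries).
apply: mx2_eqP; rewrite mxE mx2_entry; apply: complexP; rewrite /=.
- by congr oint; apply/funext => t; rewrite mx2_entry.
- by rewrite -[RHS](oint0 0 z); congr oint; apply/funext => t; rewrite mx2_entry.
- by rewrite -[RHS](oint0 0 z); congr oint; apply/funext => t; rewrite mx2_entry.
- by congr oint; apply/funext => t; rewrite mx2_entry.
- by rewrite -[RHS](oint0 0 z); congr oint; apply/funext => t; rewrite mx2_entry.
- by rewrite -(ointN _ _ Ibe); congr oint; apply/funext => t; rewrite mx2_entry.
- by congr oint; apply/funext => t; rewrite mx2_entry.
- by rewrite -[RHS](oint0 0 z); congr oint; apply/funext => t; rewrite mx2_entry.
Qed.

Lemma J_mul_oint z : Jmx *m mx_oint (Q2mx q1 q2 q) 0 z = spectral (cI (A1 z)) (cI (A2 z)).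
Proof.
rewrite mx_oint_Q2mx /A1 /A2; move: (oint al 0 z) (oint be 0 z) => a b.
apply: mx2_eqP; rewrite mulmx2E spectral_entries /Jmx !mx2_entry;
  by apply: complexP; rewrite !ReImE /=; field.
Qed.

Lemma scale_J (x : C) : - x *: Jmx = spectral (- 'i%C * x) (- (- 'i%C * x)).
Proof.
apply: mx2_eqP; rewrite spectral_entries /Jmx mxE !mx2_entry;
  by apply: complexP; rewrite !ReImE /=; field.
Qed.

(** Both exponents are of the form [a I + b J], and the eigenvalues of the product are exactly the
    exponential factors found for the two components of the diagonalized system. *)
Lemma main_term (lam : C) z :
  expmx (- (lam * z%:C%C) *: Jmx) *m expmx (Jmx *m mx_oint (Q2mx q1 q2 q) 0 z) =
  spectral (cexp (- 'i%C * lam * z%:C%C + cI (A1 z)))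
           (cexp (- (- 'i%C * lam) * z%:C%C + cI (A2 z))).
Proof.
rewrite scale_J J_mul_oint !expmx_spectral spectralM -!cexpD.
by congr (spectral (cexp _) (cexp _)); ring.
Qed.

Let aA1 : acd A1 (fun t => al t - be t).
Proof. by apply: acdB; exact: acd_oint. Qed.

Let aA2 : acd A2 (fun t => - al t - be t).
Proof. by apply: acdB; [apply: acdN|]; exact: acd_oint. Qed.

Let A10 : A1 0 = 0. Proof. by rewrite /A1 !oint_refl subrr. Qed.
Let A20 : A2 0 = 0. Proof. by rewrite /A2 !oint_refl oppr0 addr0. Qed.

Variable Y : R -> C -> 'M[C]_2.
Hypothesis Y_sol : forall lam, is_fundamental q1 q2 q lam (Y ^~ lam).
Hypothesis Y_init : forall lam, Y 0 lam = 1%:M.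

Let normc_om (lam : C) : normc (- 'i%C * lam) = normc lam.
Proof. by rewrite Normc.normcM normcN normci mul1r. Qed.

Let Re_om (lam : C) : Re (- 'i%C * lam) = Im lam.
Proof. by rewrite !ReImE /=; ring. Qed.

Lemma fundamental_asymp (T e : R) : 0 < T -> 0 < e -> exists2 r : R, 0 < r &
  forall lam, r <= normc lam -> forall z j, `|z| <= T ->
  let E := Y z lam - expmx (- (lam * z%:C%C) *: Jmx) *m
    expmx (Jmx *m mx_oint (Q2mx q1 q2 q) 0 z) in
  normc (lcoord E j) <= e * expR (`|Im lam| * `|z|) /\
  normc (rcoord E j) <= e * expR (`|Im lam| * `|z|).
Proof.
move=> T0 e0.
have [r r0 Hr] := dsystem_asymp Ik1 Ik2 aA1 aA2 A10 A20 T0 e0.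
exists r => // lam lamr z j zT E.
have omr : r <= normc (- 'i%C * lam) by rewrite normc_om.
have := Hr _ omr _ _ (fundamental_dsystem j (Y_sol lam)).
rewrite Y_init Re_om => /(_ (normc_lcoord1 j) (normc_rcoord1 j) z zT).
by rewrite /E main_term lcoordB rcoordB lcoord_spectral rcoord_spectral.
Qed.

Lemma fundamental_littleo (K : set R) : compact K -> unif_littleo K
  (fun z lam => Y z lam - expmx (- (lam * z%:C%C) *: Jmx) *m
     expmx (Jmx *m mx_oint (Q2mx q1 q2 q) 0 z))
  (fun z lam => expR `|Im (lam * z%:C%C)|).
Proof.
move=> /compact_bounded[M [_ HM]] e e0.
have T0 : 0 < `|M| + 1 by rewrite ltr_wpDl.
have e20 : 0 < e / 2 by rewrite divr_gt0.
have [r r0 Hr] := fundamental_asymp T0 e20.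
exists r; split => [|x rx theta z Kz]; first exact: num_real.
have zT : `|z| <= `|M| + 1.
  by apply: HM => //; apply: le_lt_trans (ler_norm M) _; rewrite ltrDl.
have nx : normc (polar x theta) = x.
  rewrite /polar /= !exprMn -mulrDr cos2Dsin2 mulr1 sqrtr_sqr ger0_norm//.
  exact: ltW (lt_trans r0 rx).
have rx' : r <= normc (polar x theta) by rewrite nx ltW.
have -> : Im (polar x theta * z%:C%C) = Im (polar x theta) * z.
  by rewrite ImM /= mulr0 add0r.
rewrite normrM [leRHS](_ : _ = 2 * (e / 2 * expR (`|Im (polar x theta)| * `|z|))); last first.
  by field.
by apply: opnorm_coord_le => j; exact: Hr.
Qed.

Lemma fundamental_entire z : entire (Y z).
Proof.
move=> lam; apply: derivable_mx2 => i j.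
have c1 : normc (- 'i%C : C) = 1 by rewrite normcN normci.
have s m := fundamental_dsystem j (Y_sol m).
have [|| B B0 HB] := diff_quot_cauchy lam (a1 := lcoord 1%:M j) (a2 := rcoord 1%:M j)
  z c1 Ik1 Ik2 s; [by move=> m; rewrite Y_init|by move=> m; rewrite Y_init|].
have [l1 Hl1] := cauchy_limit B0 (fun m n ml nl m0 n0 => (HB m n ml nl m0 n0).1).
have [l2 Hl2] := cauchy_limit B0 (fun m n ml nl m0 n0 => (HB m n ml nl m0 n0).2).
exists (coef1 i * l1 + coef2 i * l2); exists B => // m ml mlam.
have [n1 n2] := normc_coef (R := R) i.
rewrite (_ : _ - _ = coef1 i * (l1 - diff_quot (fun m => lcoord (Y z m) j) lam m) +
    coef2 i * (l2 - diff_quot (fun m => rcoord (Y z m) j) lam m)); last first.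
  by rewrite /diff_quot (coord_entry (Y z m)) (coord_entry (Y z lam)); ring.
apply: le_trans (le_normcD _ _) _; rewrite !Normc.normcM n1 n2.
by have := Hl1 m ml mlam; have := Hl2 m ml mlam; lra.
Qed.

(** The asymptotics with relative error [1/2] give bounds of type [|z|] from both sides. At [z = 0]
    the solution is constant in [lam], hence the exclusion. *)
Lemma fundamental_growth z : z != 0 -> growth_order (Y z) = 1%E.
Proof.
move=> z0; have T0 : 0 < `|z| by rewrite normr_gt0.
have h0 : 0 < 2^-1 :> R by rewrite invr_gt0.
have [r r0 Hr] := fundamental_asymp T0 h0.
have nP lam : normc (cexp (- 'i%C * lam * z%:C%C + cI (A1 z))) = expR (Im lam * z).
  by rewrite normc_cexp; congr expR; rewrite !ReImE /=; ring.
have nM lam : normc (cexp (- (- 'i%C * lam) * z%:C%C + cI (A2 z))) = expR (- Im lam * z).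
  by rewrite normc_cexp; congr expR; rewrite !ReImE /=; ring.
have nIm (lam : C) : `|Im lam| <= normc lam by rewrite -Re_om -normc_om normRe_le_normc.
apply: (@growth_order_eq1 _ _ `|z| 2^-1 4 r) => // [lam lamr|x rx].
  pose X := expR (`|z| * normc lam); have X0 : 0 <= X by exact: expR_ge0.
  have le1 : expR (`|Im lam| * `|z|) <= X.
    by rewrite ler_expR mulrC ler_wpM2l.
  have leP : expR (Im lam * z) <= X.
    by apply: le_trans le1; rewrite ler_expR -normrM ler_norm.
  have leM : expR (- Im lam * z) <= X.
    by apply: le_trans le1; rewrite ler_expR mulNr -normrM -[leRHS]normrN ler_norm.
  rewrite (_ : 4 * X = 2 * (2 * X)); last by ring.
  apply: opnorm_coord_le => j; have := Hr lam lamr z j (lexx _).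
  rewrite /= main_term lcoordB rcoordB lcoord_spectral rcoord_spectral => -[h1 h2].
  split.
    rewrite -[lcoord _ j](subrK (cexp (- 'i%C * lam * z%:C%C + cI (A1 z)) * lcoord 1%:M j)).
    apply: le_trans (le_normcD _ _) _; rewrite [X in _ + X]Normc.normcM nP.
    have := ler_pM (expR_ge0 (Im lam * z)) (normc_ge0 _) leP (normc_lcoord1 (R := R) j).
    by rewrite mulr1; lra.
  rewrite -[rcoord _ j](subrK (cexp (- (- 'i%C * lam) * z%:C%C + cI (A2 z)) * rcoord 1%:M j)).
  apply: le_trans (le_normcD _ _) _; rewrite [X in _ + X]Normc.normcM nM.
  have := ler_pM (expR_ge0 (- Im lam * z)) (normc_ge0 _) leM (normc_rcoord1 (R := R) j).
  by rewrite mulr1; lra.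
have x0 : 0 < x by exact: lt_le_trans rx.
(* On the imaginary axis, with the sign of [z], the main part of the first coordinate has modulus
   [e^{|z| x}], and the error is at most half of it. *)
pose lam : C := Complex 0 (if 0 < z then x else - x).
have nlam : normc lam = x.
  rewrite /= expr0n add0r sqrtr_sqr.
  by case: ifP => _; rewrite ?normrN ger0_norm// ltW.
have lamz : Im lam * z = `|z| * x.
  by rewrite /=; case: ltP => zP; [rewrite gtr0_norm//|rewrite ler0_norm//]; ring.
have Ilam : `|Im lam| = x.
  by rewrite /=; case: ifP => _; rewrite ?normrN ger0_norm// ltW.
exists lam => //; apply: le_trans (lcoord_le_opnorm _).
have rlam : r <= normc lam by rewrite nlam.
have := (Hr lam rlam z 0 (lexx _)).1.
rewrite /= main_term lcoordB lcoord_spectral -/(Im lam) Ilam [x * _]mulrC.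
rewrite lcoord_id mulr1; set P := cexp _.
have := nP lam; rewrite -/P lamz => PE H.
have := le_normcB (lcoord (Y z lam) 0) (lcoord (Y z lam) 0 - P).
rewrite (_ : _ - (_ - P) = P) ?PE; last by ring.
by move: H; lra.
Qed.

End fundamental.

(** Periodicity makes [U (z + pi)] the solution normalized at [0], so the claims on [U] are those on
    [Y] moved by [pi]. Both exponents of its main term therefore contain [z - pi], as for [Q = 0],
    where [U] is [exp (- lam (z - pi) J)]. Uniformity in [z] is over compact sets: the energy
    constant and the Riemann-Lebesgue threshold depend on the length of the interval. *)
Theorem lemma3p1 (R : realType) (q1 q2 : R -> R) (q : R -> R[i])
    (Q_periodic : forall t, Qmx q1 q2 q (t + pi) = Qmx q1 q2 q t)
    (Q_integrable : mx_integrable `[0, pi[ (Qmx q1 q2 q))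
    (Y U : R -> R[i] -> 'M[R[i]]_2)
    (Y_sol : forall lam, is_solution (Qmx q1 q2 q) lam (fun z => Y z lam))
    (Y_init : forall lam, Y 0 lam = 1%:M)
    (U_sol : forall lam, is_solution (Qmx q1 q2 q) lam (fun z => U z lam))
    (U_init : forall lam, U pi lam = 1%:M) :
  [/\ (forall z, entire (Y z)) /\
        (forall z, z != 0 -> growth_order (Y z) = 1%E),
      (forall z, entire (U z)) /\
        (forall z, z != pi -> growth_order (U z) = 1%E),
      (forall K : set R, compact K ->
        unif_littleo K
          (fun z lam => Y z lam -
             expmx (- (lam * z%:C%C) *: Jmx)
               *m expmx (Jmx *m mx_oint (Q2mx q1 q2 q) 0 z))
          (fun z lam => expR `|complex.Im (lam * z%:C%C)|)) &
      (forall K : set R, compact K ->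
        unif_littleo K
          (fun z lam => U z lam -
             expmx (- (lam * (z - pi)%:C%C) *: Jmx)
               *m expmx (Jmx *m mx_oint (Q2mx q1 q2 q) 0 (z - pi)))
          (fun z lam => expR `|complex.Im (lam * (pi - z)%:C%C)|))].
Proof.
have q1P t : q1 (t + pi) = q1 t.
  have := congr1 (fun A : 'M[R[i]]_2 => complex.Re (A 0 0)) (Q_periodic t).
  by rewrite /Qmx !mx2_entry.
have q2P t : q2 (t + pi) = q2 t.
  have := congr1 (fun A : 'M[R[i]]_2 => complex.Re (A 1 1)) (Q_periodic t).
  by rewrite /Qmx !mx2_entry.
have qP t : q (t + pi) = q t.
  have := congr1 (fun A : 'M[R[i]]_2 => A 0 1) (Q_periodic t).
  by rewrite /Qmx !mx2_entry.
have Iq1 : locint q1.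
  apply: (locint_periodic (pi_gt0 R)) => //; have [+ _] := Q_integrable 0 0.
  by congr (_.-integrable _ _); apply/funext => t; rewrite /Qmx mx2_entry.
have Iq2 : locint q2.
  apply: (locint_periodic (pi_gt0 R)) => //; have [+ _] := Q_integrable 1 1.
  by congr (_.-integrable _ _); apply/funext => t; rewrite /Qmx mx2_entry.
have Iq : clocint q.
  have [Iqr Iqi] := Q_integrable 0 1.
  split; apply: (locint_periodic (pi_gt0 R)) => [|t]; rewrite ?qP//.
    by move: Iqr; congr (_.-integrable _ _); apply/funext => t; rewrite /Qmx mx2_entry.
  by move: Iqi; congr (_.-integrable _ _); apply/funext => t; rewrite /Qmx mx2_entry.
have Y_fund lam := is_solution_fundamental (Y_sol lam).
pose V z lam := U (z + pi) lam.
have V_fund lam : is_fundamental q1 q2 q lam (V ^~ lam).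
  move=> j; have [D0 D1] := is_solution_fundamental (U_sol lam) j; split.
    by apply: cacd_ext (cacd_shift pi D0) _ _ => // t; rewrite qP q2P.
  by apply: cacd_ext (cacd_shift pi D1) _ _ => // t; rewrite qP q1P.
have V_init lam : V 0 lam = 1%:M by rewrite /V add0r.
have UV z : U z = V (z - pi) by apply/funext => lam; rewrite /V subrK.
split.
- split=> z; first exact: (fundamental_entire Iq1 Iq2 Iq Y_fund Y_init (z := z)).
  exact: (fundamental_growth Iq1 Iq2 Iq Y_fund Y_init (z := z)).
- split=> z; rewrite UV.
    exact: (fundamental_entire Iq1 Iq2 Iq V_fund V_init (z := z - pi)).
  move=> zpi; apply: (fundamental_growth Iq1 Iq2 Iq V_fund V_init (z := z - pi)).
  by rewrite subr_eq0.
- by move=> K cK; exact: (fundamental_littleo Iq1 Iq2 Iq Y_fund Y_init cK).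
- move=> K cK e e0.
  have cK' : compact [set z - pi | z in K].
    apply: continuous_compact => //; apply: continuous_subspaceT => z.
    by apply: cvgB; [exact: cvg_id|exact: cvg_cst].
  have := fundamental_littleo Iq1 Iq2 Iq V_fund V_init cK' e0.
  apply: filterS => r H theta z Kz; rewrite UV.
  have {}H := H theta (z - pi) (ex_intro2 _ _ z Kz erefl).
  apply: le_trans H _; rewrite !ImM /= !mulr0 !add0r.
  by rewrite -(opprB z pi) mulrN normrN.
Qed.
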